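(* Let $k=(k_1,\ldots,k_l)$ be a partition of $d$ and let $X=\bigcup_{\sigma\in\mathfrak{S}_l}\mathcal{P}_{k,\sigma}\subseteq(\mathbb{C}^n)^{\otimes d}$ be the partition-rank-$1$ variety associated to $k$. The generic partition rank $r_g$ with respect to $k$ is bounded by $$r_g\le\frac{n^d}{n^{k_1}+\ldots+n^{k_l}-l+1}+(n^{k_1}+\ldots+n^{k_l}-l+1).$$ Moreover, $X$ is $r$-nondefective for $$r<\frac{n^d}{n^{k_1}+\ldots+n^{k_l}-l+1}-(n^{k_1}+\ldots+n^{k_l}-l+1).$$
   Context: Let $d\in\mathbb{N}$ and let $k_1,\ldots,k_l$ be positive integers with $d=k_1+\ldots+k_l$. For $\sigma\in\mathfrak{S}_l$ (the symmetric group on $\{1,\ldots,l\}$) put $$\mathcal{P}_{k,\sigma}:=\{t_{\sigma(1)}\otimes\ldots\otimes t_{\sigma(l)}\mid t_i\in(\mathbb{C}^n)^{\otimes k_i}\}\subseteq(\mathbb{C}^n)^{\otimes d}.$$ These are irreducible affine cones. The $k$-partition rank of a tensor $T\in(\mathbb{C}^n)^{\otimes d}$ is the minimum $r\in\mathbb{N}_0$ such that $T$ is a sum of $r$ elements of $X=\bigcup_\sigma\mathcal{P}_{k,\sigma}$. The generic partition rank $r_g$ with respect to $k$ is the $k$-partition rank of a general tensor in $(\mathbb{C}^n)^{\otimes d}$, i.e. the smallest $r$ such that the $r$-th secant variety $\sigma_r(X)$ (the Zariski closure of the set of sums of $r$ elements of $X$) equals $(\mathbb{C}^n)^{\otimes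 d}$. For affine cones $Y_1,\ldots,Y_r$ in a vector space $V$, the join $J(Y_1,\ldots,Y_r)$ is the Zariski closure of $\{y_1+\ldots+y_r\mid y_i\in Y_i\}$; for irreducible $Y_i$ it is defective if $\dim J(Y_1,\ldots,Y_r)<\min\{\dim Y_1+\ldots+\dim Y_r,\dim V\}$. An affine cone $X$ with irreducible components $X_1,\ldots,X_c$ is $r$-defective if any of the joins $J(X_{i_1},\ldots,X_{i_r})$ with $i_1,\ldots,i_r\in\{1,\ldots,c\}$ is defective, and $r$-nondefective otherwise. *)

(* Defs.v *)
From mathcomp Require Import all_boot all_order all_fingroup all_algebra.
From mathcomp Require Import boolp classical_sets reals.
From mathcomp Require Import complex mpoly.

Set Implicit Arguments.
Unset Strict Implicit.
Unset Printing Implicit Defensive.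
Import GRing.Theory.
Local Open Scope classical_set_scope.
Local Open Scope ring_scope.

Section Zariski.
Variables (F : fieldType) (I : finType).

(* The affine space F^I; polynomial functions on it are evaluations of
   polynomials in #|I| variables, one for each element of I. *)
Local Notation V := {ffun I -> F}.

Definition poly_eval (p : {mpoly F[#|I|]}) (v : V) : F :=
  p.@[fun j => v (enum_val j)].

Definition zariski_closed (Y : set V) : Prop :=
  exists S : set {mpoly F[#|I|]},
    Y = [set v | forall p, S p -> poly_eval p v = 0].

Definition zariski_closure (Y : set V) : set V :=
  [set v | forall Z, zariski_closed Z -> Y `<=` Z -> Z v].

Definition irreducible (Y : set V) : Prop :=
  Y !=set0 /\
  forall A B : set V, zariski_closed A -> zariski_closed B ->
    Y `<=` A `|` B -> Y `<=` A \/ Y `<=` B.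

(* Z 0 `<` ... `<` Z m is a chain of irreducible closed subsets. *)
Definition irreducible_chain (Y : set V) (m : nat) (Z : nat -> set V) : Prop :=
  (forall i, (i <= m)%N ->
     [/\ zariski_closed (Z i), irreducible (Z i) & Z i `<=` Y]) /\
  (forall i, (i < m)%N -> Z i `<` Z i.+1).

(* Krull dimension of the Zariski closure of Y, i.e. the largest length of a
   chain; the default value 0 only occurs for the empty set, as chains in F^I
   have length at most #|I|. *)
Definition zariski_dim (Y : set V) : nat :=
  xget 0%N [set m |
    (exists Z, irreducible_chain (zariski_closure Y) m Z) /\
    forall m' Z, irreducible_chain (zariski_closure Y) m' Z -> (m' <= m)%N].

Definition irreducible_component (X Y : set V) : Prop :=
  [/\ irreducible Y, Y `<=` X &
      forall Y', irreducible Y' -> Y' `<=` X -> Y `<=` Y' -> Y' = Y].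

Definition join (r : nat) (Y : 'I_r -> set V) : set V :=
  zariski_closure
    [set v | exists y : 'I_r -> V, (forall i, Y i (y i)) /\ v = \sum_i y i].

(* Here #|I| is the dimension of the vector space F^I. *)
Definition defective_join (r : nat) (Y : 'I_r -> set V) : Prop :=
  (zariski_dim (join Y) < minn (\sum_i zariski_dim (Y i)) #|I|)%N.

Definition r_defective (X : set V) (r : nat) : Prop :=
  exists Y : 'I_r -> set V,
    (forall i, irreducible_component X (Y i)) /\ defective_join Y.

Definition r_nondefective (X : set V) (r : nat) : Prop := ~ r_defective X r.

Definition secant (X : set V) (r : nat) : set V := join (fun _ : 'I_r => X).

Definition is_generic_rank (X : set V) (r : nat) : Prop :=
  secant X r = setT /\ forall s, secant X s = setT -> (r <= s)%N.

End Zariski.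

(* (F^n)^{\otimes d}, in coordinates with respect to the standard basis
   e_{w 0} \otimes ... \otimes e_{w (d-1)}. *)
Notation tensor F n d := {ffun {ffun 'I_d -> 'I_n} -> F}.

Section PartitionRank.
Variables (F : fieldType) (n l : nat) (k : 'I_l -> nat).

Lemma sum_perm (s : 'S_l) : (\sum_j k (s j) = \sum_i k i)%N.
Proof. by rewrite [RHS](reindex_inj (@perm_inj _ s)). Qed.

(* The positions 0, ..., d-1 are cut into consecutive blocks of lengths
   k (s 0), ..., k (s (l-1)); block_word s w j is the restriction of the
   multi-index w to the j-th block. *)
Definition block_word (s : 'S_l) (w : {ffun 'I_(\sum_i k i)%N -> 'I_n})
    (j : 'I_l) : {ffun 'I_(k (s j)) -> 'I_n} :=
  [ffun a => w (cast_ord (sum_perm s)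
                  (@tagnat.Rank l (fun j => k (s j)) j a))].

(* t_{s 0} \otimes ... \otimes t_{s (l-1)} *)
Definition tensor_prod (s : 'S_l) (t : forall i, tensor F n (k i)) :
    tensor F n (\sum_i k i)%N :=
  [ffun w => \prod_j t (s j) (block_word s w j)].

Definition partition_cone (s : 'S_l) : set (tensor F n (\sum_i k i)%N) :=
  [set T | exists t, T = tensor_prod s t].

Definition partition_rank1 : set (tensor F n (\sum_i k i)%N) :=
  [set T | exists s, partition_cone s T].

End PartitionRank.

(* Main.v *)
(** Parametrize the cone of a permutation by families of block tensors. For
    general points, let W be the sum of the tangent spaces at points of the cones
    s = (s_1, ..., s_r), and let a_c(s) = dim (T_x /\ W) for a further general
    point x of the cone c. Suppose that a_c(s) > 0 and that adding a point of any
    of the cones s_i does not increase a_c. Then T_x /\ W does not change when the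
    points of s are replaced one at a time by other general points, so it is
    contained in every general W of type s. All the cones are stable under
    GL_n x ... x GL_n, which acts irreducibly on the tensors, so W is the whole
    space. Hence, once a join is defective, a_c grows with each suitable further
    summand until the space is filled, which happens after fewer than D more
    summands, D being the dimension of the cones; comparing dimensions gives both
    bounds.

    The Krull dimension of the closure of the image of a polynomial map lies
    between the rank of its differential (take closures of images of a flag of
    linear subspaces transversal to the kernel) and its number of parameters
    (algebraic dependence, by counting monomials). *)
Require Import Defs.
From mathcomp Require Import all_boot all_order all_fingroup all_algebra.
From mathcomp Require Import boolp classical_sets reals.
From mathcomp Require Import complex mpoly.
From mathcomp Require Import zify.

Set Implicit Arguments.
Unset Strict Implicit.
Unset Printing Implicit Defensive.
Import Order.TTheory GRing.Theory Num.Theory.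
Local Open Scope ring_scope.

(** * Polynomial functions *)

Section Cofinite.
Variable F : numFieldType.
Implicit Types (P Q : F -> Prop) (q : {poly F}).

Lemma poly_horner_neq0 q : q != 0 -> exists s, q.[s] != 0.
Proof.
move=> q0; apply: contrapT => H.
have /(max_poly_roots q0) : all (root q) [seq i%:R | i <- iota 0 (size q)].
  apply/allP => s _; rewrite /root; apply/negPn/negP => /negP qs.
  by apply: H; exists s; apply/negP.
rewrite size_map size_iota ltnn map_inj_uniq ?iota_uniq //; first by move/(_ isT).
exact: (mulrIn (oner_neq0 F)).
Qed.

(** One nonzero polynomial is the witness: conjunctions become products, and a nonroot always exists
    in characteristic zero. *)
Definition cofinite P := exists2 q, q != 0 & forall s, q.[s] != 0 -> P s.

Lemma cofinite_and P Q : cofinite P -> cofinite Q -> cofinite (fun s => P s /\ Q s).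
Proof.
move=> [p p0 Pp] [q q0 Qq]; exists (p * q); first by rewrite mulf_neq0.
by move=> s; rewrite hornerM mulf_eq0 negb_or => /andP[/Pp ? /Qq].
Qed.

Lemma cofinite_impl P Q : cofinite P -> (forall s, P s -> Q s) -> cofinite Q.
Proof. by move=> [p p0 Pp] PQ; exists p => // s /Pp/PQ. Qed.

Lemma cofinite_all P : (forall s, P s) -> cofinite P.
Proof. by move=> PT; exists 1; rewrite ?oner_neq0. Qed.

Lemma cofinite_ex P : cofinite P -> exists s, P s.
Proof. by move=> [p /poly_horner_neq0[s ps] Pp]; exists s; apply: Pp. Qed.

Lemma cofinite_horner q s0 : q.[s0] != 0 -> cofinite (fun s => q.[s] != 0).
Proof. by move=> q0; exists q => //; apply: contraNneq q0 => ->; rewrite horner0. Qed.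

Lemma cofinite_neq a : cofinite (fun s => s != a).
Proof.
apply: cofinite_impl (@cofinite_horner ('X - a%:P) (a + 1) _) _ => [|s].
  by rewrite !hornerE addrAC subrr add0r oner_neq0.
by rewrite !hornerE subr_eq0.
Qed.

Lemma cofinite_allT (I : eqType) (r : seq I) (P : I -> F -> Prop) :
  (forall i, i \in r -> cofinite (P i)) ->
  cofinite (fun s => forall i, i \in r -> P i s).
Proof.
elim: r => [|i r IH] H; first exact: cofinite_all.
apply: cofinite_impl (cofinite_and (H i (mem_head i r)) (IH _)) _.
  by move=> j jr; apply: H; rewrite in_cons jr orbT.
by move=> s [Pi Pr] j; rewrite in_cons => /predU1P[->//|/Pr].
Qed.

Lemma cofinite_poly_eq0 q : cofinite (fun s => q.[s] = 0) -> q = 0.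
Proof.
move=> cq; apply/eqP/contraT => /poly_horner_neq0[s0 /cofinite_horner cq'].
by have /cofinite_ex[s [-> /eqP]] := cofinite_and cq cq'.
Qed.

End Cofinite.

Section PolynomialFunctions.
Variable F : numFieldType.

(** An inductive predicate allows any type of variables, also [nat], and proofs by induction;
    [polyfun_mpoly] returns to [mpoly] when the type is finite. *)
Inductive polyfun (K : Type) : ((K -> F) -> F) -> Prop :=
| polyfun_const c : polyfun (fun=> c)
| polyfun_var k : polyfun (fun x => x k)
| polyfun_add f g : polyfun f -> polyfun g -> polyfun (fun x => f x + g x)
| polyfun_mul f g : polyfun f -> polyfun g -> polyfun (fun x => f x * g x).

Lemma polyfun_sum K (I : Type) (r : seq I) (P : pred I) (f : I -> (K -> F) -> F) :
  (forall i, P i -> polyfun (f i)) -> polyfun (fun x => \sum_(i <- r | P i) f i x).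
Proof.
move=> pf; elim: r => [|i r IH].
  rewrite (_ : (fun _ => _) = fun=> 0); first exact: polyfun_const.
  by apply: funext => x; rewrite big_nil.
have [Pi|nPi] := boolP (P i); last first.
  rewrite (_ : (fun _ => _) = fun x => \sum_(j <- r | P j) f j x) //.
  by apply: funext => x; rewrite big_cons (negbTE nPi).
rewrite (_ : (fun _ => _) = fun x => f i x + \sum_(j <- r | P j) f j x).
  by apply: polyfun_add => //; apply: pf.
by apply: funext => x; rewrite big_cons Pi.
Qed.

Lemma polyfun_prod K (I : Type) (r : seq I) (P : pred I) (f : I -> (K -> F) -> F) :
  (forall i, P i -> polyfun (f i)) -> polyfun (fun x => \prod_(i <- r | P i) f i x).
Proof.
move=> pf; elim: r => [|i r IH].
  rewrite (_ : (fun _ => _) = fun=> 1); first exact: polyfun_const.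
  by apply: funext => x; rewrite big_nil.
have [Pi|nPi] := boolP (P i); last first.
  rewrite (_ : (fun _ => _) = fun x => \prod_(j <- r | P j) f j x) //.
  by apply: funext => x; rewrite big_cons (negbTE nPi).
rewrite (_ : (fun _ => _) = fun x => f i x * \prod_(j <- r | P j) f j x).
  by apply: polyfun_mul => //; apply: pf.
by apply: funext => x; rewrite big_cons Pi.
Qed.

Lemma polyfun_exp K f n : @polyfun K f -> polyfun (fun x => f x ^+ n).
Proof.
move=> pf; rewrite (_ : (fun _ => _) = fun x => \prod_(i < n) f x).
  exact: polyfun_prod.
by apply: funext => x; rewrite prodr_const card_ord.
Qed.

Lemma polyfun_comp K L f (g : K -> (L -> F) -> F) :
  @polyfun K f -> (forall k, polyfun (g k)) -> polyfun (fun x => f (g^~ x)).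
Proof.
move=> pf pg; elim: pf => [c|k|f1 f2 _ IH1 _ IH2|f1 f2 _ IH1 _ IH2].
- exact: polyfun_const.
- exact: pg.
- exact: polyfun_add IH1 IH2.
- exact: polyfun_mul IH1 IH2.
Qed.

(** Genericity is tested along polynomial curves, where it becomes a question about roots of a
    polynomial in one variable. *)
Lemma polyfun_curve K f (c : K -> {poly F}) : polyfun f ->
  exists q : {poly F}, forall s, f (fun k => (c k).[s]) = q.[s].
Proof.
elim=> [a|k|f1 f2 _ [p1 E1] _ [p2 E2]|f1 f2 _ [p1 E1] _ [p2 E2]].
- by exists a%:P => s; rewrite hornerE.
- by exists (c k).
- by exists (p1 + p2) => s; rewrite hornerE E1 E2.
- by exists (p1 * p2) => s; rewrite hornerE E1 E2.
Qed.

(** [G x] is f(tx) as a polynomial in t; its coefficients are the homogeneous parts of f at x. *)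
Lemma polyfun_homog K f : @polyfun K f ->
  exists e (G : (K -> F) -> {poly F}),
  [/\ forall x, (size (G x) <= e)%N, forall j, polyfun (fun x => (G x)`_j),
      forall s x j, (G (fun k => s * x k))`_j = s ^+ j * (G x)`_j &
      forall x, f x = (G x).[1]].
Proof.
elim=> [a|k|f1 f2 _ [e1 [G1 [s1 p1 h1 E1]]] _ [e2 [G2 [s2 p2 h2 E2]]]
  |f1 f2 _ [e1 [G1 [s1 p1 h1 E1]]] _ [e2 [G2 [s2 p2 h2 E2]]]].
- exists 1%N, (fun=> a%:P); split => [x|j|s x [|j]|x].
  + exact: size_polyC_leq1.
  + exact: polyfun_const.
  + by rewrite expr0 mul1r.
  + by rewrite coefC mulr0.
  + by rewrite hornerE.
- exists 2%N, (fun x => x k *: 'X); split => [x|j|s x j|x].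
  + by apply: leq_trans (size_scale_leq _ _) _; rewrite size_polyX.
  + rewrite (_ : (fun _ => _) = fun x => x k * ('X : {poly F})`_j).
      by apply: polyfun_mul; [exact: polyfun_var|exact: polyfun_const].
    by apply: funext => x; rewrite coefZ.
  + rewrite !coefZ coefX; case: eqP => [->|_]; last by rewrite !mulr0.
    by rewrite expr1 mulrA.
  + by rewrite !hornerE.
- exists (maxn e1 e2), (fun x => G1 x + G2 x); split => [x|j|s x j|x].
  + by apply: leq_trans (size_polyD _ _) _; rewrite geq_max !leq_max s1 s2 orbT.
  + rewrite (_ : (fun _ => _) = fun x => (G1 x)`_j + (G2 x)`_j).
      exact: polyfun_add.
    by apply: funext => x; rewrite coefD.
  + by rewrite !coefD h1 h2 mulrDr.
  + by rewrite hornerE E1 E2.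
- exists (e1 + e2)%N, (fun x => G1 x * G2 x); split => [x|j|s x j|x].
  + apply: leq_trans (size_polyMleq _ _) (leq_trans (leq_pred _) _).
    exact: leq_add.
  + rewrite (_ : (fun _ => _) =
        fun x => \sum_(i < j.+1) (G1 x)`_i * (G2 x)`_(j - i)).
      by apply: polyfun_sum => i _; apply: polyfun_mul.
    by apply: funext => x; rewrite coefM.
  + rewrite !coefM big_distrr; apply: eq_bigr => i _ /=.
    rewrite h1 h2 mulrACA -exprD subnKC //; exact: (ltn_ord i).
  + by rewrite hornerE E1 E2.
Qed.

(** [G x] is f as a polynomial in the variable k, with coefficients in the other variables. *)
Lemma polyfun_split (K : eqType) f (k : K) : polyfun f ->
  exists e (G : (K -> F) -> {poly F}),
  [/\ forall x, (size (G x) <= e)%N, forall j, polyfun (fun x => (G x)`_j),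
      forall x y, (forall i, i != k -> x i = y i) -> G x = G y &
      forall x, f x = (G x).[x k]].
Proof.
elim=> [a|i|f1 f2 _ [e1 [G1 [s1 p1 h1 E1]]] _ [e2 [G2 [s2 p2 h2 E2]]]
  |f1 f2 _ [e1 [G1 [s1 p1 h1 E1]]] _ [e2 [G2 [s2 p2 h2 E2]]]].
- exists 1%N, (fun=> a%:P); split => [x|j|x y|x] //.
  + exact: size_polyC_leq1.
  + exact: polyfun_const.
  + by rewrite hornerE.
- have [->|ik] := eqVneq i k.
    exists 2%N, (fun=> 'X); split => [x|j|x y|x] //.
    + by rewrite size_polyX.
    + exact: polyfun_const.
    + by rewrite hornerE.
  exists 1%N, (fun x => (x i)%:P); split => [x|[|j]|x y xy|x] //.
  + exact: size_polyC_leq1.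
  + rewrite (_ : (fun _ => _) = fun x => x i); first exact: polyfun_var.
    by apply: funext => x; rewrite coefC.
  + rewrite (_ : (fun _ => _) = fun x => 0); first exact: polyfun_const.
    by apply: funext => x; rewrite coefC.
  + by rewrite xy.
  + by rewrite hornerE.
- exists (maxn e1 e2), (fun x => G1 x + G2 x); split => [x|j|x y xy|x].
  + by apply: leq_trans (size_polyD _ _) _; rewrite geq_max !leq_max s1 s2 orbT.
  + rewrite (_ : (fun _ => _) = fun x => (G1 x)`_j + (G2 x)`_j).
      exact: polyfun_add.
    by apply: funext => x; rewrite coefD.
  + by rewrite (h1 x y xy) (h2 x y xy).
  + by rewrite hornerE E1 E2.
- exists (e1 + e2)%N, (fun x => G1 x * G2 x); split => [x|j|x y xy|x].
  + apply: leq_trans (size_polyMleq _ _) (leq_trans (leq_pred _) _).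
    exact: leq_add.
  + rewrite (_ : (fun _ => _) =
        fun x => \sum_(i < j.+1) (G1 x)`_i * (G2 x)`_(j - i)).
      by apply: polyfun_sum => i _; apply: polyfun_mul.
    by apply: funext => x; rewrite coefM.
  + by rewrite (h1 x y xy) (h2 x y xy).
  + by rewrite hornerE E1 E2.
Qed.

Lemma polyfun_meval n (p : {mpoly F[n]}) : polyfun (fun x => p.@[x]).
Proof.
rewrite (_ : (fun _ => _) =
  fun x => \sum_(m <- msupp p) p@_m * \prod_i x i ^+ m i).
  apply: polyfun_sum => m _; apply: polyfun_mul; first exact: polyfun_const.
  by apply: polyfun_prod => i _; apply: polyfun_exp; apply: polyfun_var.
by apply: funext => x; rewrite mevalE.
Qed.

Lemma polyfun_mpoly (K : finType) f : @polyfun K f ->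
  exists p : {mpoly F[#|K|]}, forall x, f x = p.@[fun j => x (enum_val j)].
Proof.
elim=> [a|k|f1 f2 _ [p1 E1] _ [p2 E2]|f1 f2 _ [p1 E1] _ [p2 E2]].
- by exists a%:MP => x; rewrite mevalC.
- by exists 'X_(enum_rank k) => x; rewrite mevalXU enum_rankK.
- by exists (p1 + p2) => x; rewrite mevalD E1 E2.
- by exists (p1 * p2) => x; rewrite mevalM E1 E2.
Qed.

Lemma polyfun_poly_eval (I : finType) (p : {mpoly F[#|I|]}) :
  exists2 f, polyfun f & forall v : {ffun I -> F}, poly_eval p v = f v.
Proof.
exists (fun x : I -> F => p.@[fun j => x (enum_val j)]) => //.
apply: (@polyfun_comp _ _ _ (fun j x => x (enum_val j)) (polyfun_meval p)) => k.
exact: polyfun_var.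
Qed.

(* The lowest nonvanishing homogeneous part of f at the origin vanishes on the
   tangent cone. *)
Lemma polyfun_tangent_cone K f (Y : (K -> F) -> Prop) : polyfun f ->
  (forall d : K -> F, exists z : K -> {poly F}, (forall k, (z k).[0] = d k) /\
     forall s, Y (fun k => s * (z k).[s])) ->
  (forall y, Y y -> f y = 0) -> forall x, f x = 0.
Proof.
move=> /polyfun_homog[e [G [sG pG hG EG]]] HY fY.
suff H j x : (G x)`_j = 0.
  by move=> x; rewrite EG (_ : G x = 0) ?horner0 //; apply/polyP => j; rewrite H coef0.
elim/ltn_ind: j x => j IH d.
have [z [z0 zY]] := HY d.
have /choice[q Eq] i : exists q : {poly F},
    forall s, (G (fun k => (z k).[s]))`_i = q.[s] by have := polyfun_curve z (pG i).
have qsum s : \sum_(i < e) s ^+ i * (q i).[s] = 0.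
  rewrite -[RHS](fY _ (zY s)) EG (@horner_coef_wide _ e) //.
  by apply: eq_bigr => i _; rewrite hG expr1n mulr1 Eq.
have [ej|je] := leqP e j.
  by rewrite nth_default // (leq_trans (sG d)).
(* The terms below j vanish by induction, so s^j can be cancelled along the curve; at 0 the quotient
   is the j-th homogeneous part at d. *)
have : \sum_(i < e | (j <= i)%N) 'X ^+ (i - j) * q i = 0.
  apply: cofinite_poly_eq0; apply: cofinite_impl (cofinite_neq 0) _ => s s0.
  have := qsum s; rewrite (bigID (fun i : 'I_e => (j <= i)%N)) /= addrC big1.
    rewrite add0r => Es.
    have : s ^+ j * (\sum_(i < e | (j <= i)%N) 'X ^+ (i - j) * q i).[s] = 0.
      rewrite -[RHS]Es horner_sum big_distrr; apply: eq_bigr => i ji /=.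
      by rewrite hornerM hornerXn mulrA -exprD subnKC.
    by move/eqP; rewrite mulf_eq0 expf_eq0 (negbTE s0) andbF => /eqP.
  by move=> i; rewrite -ltnNge => ij; rewrite -Eq IH // mulr0.
move/(congr1 (horner^~ 0)); rewrite horner0 horner_sum (bigD1 (Ordinal je)) //=.
rewrite subnn expr0 mul1r -Eq (_ : (fun k => _) = d); last exact: funext.
rewrite big1 ?addr0 // => i /andP[ji ij].
rewrite hornerM hornerXn expr0n subn_eq0 leqNgt ltn_neqAle ji andbT.
by rewrite eq_sym [_ == j](negbTE ij) mul0r.
Qed.

End PolynomialFunctions.

(** * Algebraic dependence of more polynomials than variables *)

Section AlgebraicDependence.
Variable F : numFieldType.

Lemma card_bmultinom_le n b : (#|{: 'X_{1..n < b.+1}}| <= b.+1 ^ n)%N.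
Proof.
pose h (m : 'X_{1..n < b.+1}) : {ffun 'I_n -> 'I_b.+1} := [ffun i => inord (m i)].
have h_inj : injective h.
  move=> m1 m2 /ffunP E; apply/val_inj/mnmP => i; move: (E i); rewrite !ffunE.
  have le (m : 'X_{1..n < b.+1}) : (m i < b.+1)%N.
    apply: leq_ltn_trans (bmdeg m); rewrite mdegE (bigD1 i) //=; exact: leq_addr.
  by move/(congr1 val); rewrite /= !inordK.
by have := leq_card h h_inj; rewrite card_ffun !card_ord.
Qed.

Lemma msize_prod_le n (I : Type) (r : seq I) (P : pred I)
    (f : I -> {mpoly F[n]}) E : (forall i, P i -> msize (f i) <= E)%N ->
  (msize (\prod_(i <- r | P i) f i)%R <= (size r * E).+1)%N.
Proof.
move=> fE; elim: r => [|i r IH]; first by rewrite big_nil msize1.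
rewrite big_cons; case: ifP => Pi; last first.
  by apply: leq_trans IH _; rewrite ltnS leq_mul2r /= leqnSn orbT.
set g := \prod_(j <- r | _) _ in IH *.
have [->|fi0] := eqVneq (f i) 0; first by rewrite mul0r msize0.
have [->|g0] := eqVneq g 0; first by rewrite mulr0 msize0.
rewrite msizeM // mulSn -addnS; case: (msize (f i)) (fE i Pi) => [|e] eE //=.
  by apply: leq_trans (leq_pred _) (leq_trans IH (leq_addl _ _)).
by rewrite ltnW // -addSn leq_add.
Qed.

Lemma msize_prod_fin_le n (I : finType) (P : pred I) (f : I -> {mpoly F[n]}) E :
  (forall i, P i -> msize (f i) <= E)%N ->
  (msize (\prod_(i | P i) f i)%R <= (#|I| * E).+1)%N.
Proof.
by move=> fE; have := msize_prod_le (index_enum I) fE;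
rewrite [X in size X]unlock -enumT -cardT.
Qed.

Lemma row_left_kernel m n (A : 'M[F]_(m, n)) : (n < m)%N ->
  exists2 v : 'rV_m, v != 0 & v *m A = 0.
Proof.
move=> nm; have k0 : kermx A != 0.
  by rewrite kermx_eq0 -row_leq_rank -ltnNge (leq_ltn_trans (rank_leq_col A)).
have /rowV0Pn[v vk v0] := k0; exists v => //; exact/sub_kermxP.
Qed.

(* Counting: M^m Lagrange polynomials on the grid {0,...,M-1}^m, substituted,
   lie in a space of dimension O(M^#|K|). *)
Lemma polyfun_dependent (K : finType) m (q : 'I_m -> (K -> F) -> F) :
  (forall k, polyfun (q k)) -> (#|K| < m)%N ->
  exists g : ('I_m -> F) -> F,
    [/\ polyfun g, exists x, g x != 0 & forall x, g (q^~ x) = 0].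
Proof.
move=> pfq Km.
have /choice[p pq] k := polyfun_mpoly (pfq k).
set e := #|K| in p pq Km.
pose E := (\sum_k msize (p k)).+1.
(* The power beats the constant factor in the count of monomials, and the summand m absorbs the
   additive terms of S + 1, so that (S+1)^e <= M^e (mE+1)^e < M^m. *)
pose M := ((m * E).+1 ^ e + m).+1; pose W := {ffun 'I_m -> 'I_M}.
pose L (a : W) := \prod_k \prod_(b : 'I_M | b != a k) (p k - b%:R%:MP).
pose S := (m * (M * E).+1)%N.
have sL a : (msize (L a) <= S.+1)%N.
  rewrite /S -[in leqRHS](card_ord m).
  apply: msize_prod_fin_le => k _; rewrite -[in leqRHS](card_ord M).
  apply: msize_prod_fin_le => b _.
  apply: leq_trans (msizeD_le _ _) _; rewrite geq_max msizeN msizeC.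
  by rewrite /E (bigD1 k) //= -addnS leq_addr addnS; case: (_ != 0).
pose U : finType := 'X_{1..e < S.+1}; pose N := #|U|.
pose A : 'M[F]_(#|W|, N) := \matrix_(i, j) (L (enum_val i))@_(enum_val j : U).
have NW : (N < #|W|)%N.
  apply: leq_ltn_trans (card_bmultinom_le _ _) _.
  rewrite card_ffun !card_ord.
  have SM : (S.+1 <= M * (m * E).+1)%N.
    by rewrite /S mulnS [leqRHS]mulnS [in leqRHS]mulnCA -addSn leq_add2r ltnS leq_addl.
  apply: (@leq_ltn_trans (M ^ e * (m * E).+1 ^ e)%N).
    rewrite -expnMn; case: (e) => [|e1]; rewrite ?expn0 ?leq_exp2r //.
  apply: (@leq_trans (M ^ e.+1)%N); last by rewrite leq_pexp2l.
  by rewrite expnSr ltn_pmul2l ?expn_gt0 // ltnS leq_addr.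
have [v v0 vA] := row_left_kernel A NW.
(* A linear relation v between the substituted Lagrange polynomials is a relation between the q k.
   It is nonzero at a grid point a with v_a nonzero, where the other Lagrange polynomials vanish. *)
exists (fun x => \sum_(a : W) v 0 (enum_rank a) *
   \prod_k \prod_(b : 'I_M | b != a k) (x k - b%:R)); split.
- apply: polyfun_sum => a _; apply: polyfun_mul; first exact: polyfun_const.
  apply: polyfun_prod => k _; apply: polyfun_prod => b _.
  by apply: polyfun_add; [exact: polyfun_var|exact: polyfun_const].
- have [i vi] : exists i, v 0 i != 0.
    by apply/existsP; apply: contraR v0 => /existsPn H; apply/eqP/rowP => i;
       rewrite mxE; apply/eqP; rewrite -[_ == _]negbK; apply: H.
  pose a : W := enum_val i; exists (fun k => (a k)%:R).
  rewrite (bigD1 a) //= [X in _ + X]big1 ?addr0 => [|c ca].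
    rewrite enum_valK mulf_neq0 //; apply/prodf_neq0 => k _.
    by apply/prodf_neq0 => b ba; rewrite subr_eq0 eqr_nat eq_sym.
  have /existsP[k ck] : [exists k, c k != a k].
    apply: contraR ca => /existsPn H; apply/eqP/ffunP => k.
    by apply/eqP; rewrite -[_ == _]negbK; apply: H.
  rewrite (bigD1 k) //= [X in _ * (X * _)](bigD1 (a k)) //= 1?eq_sym //.
  by rewrite subrr !mul0r mulr0.
- move=> x; pose P := \sum_(a : W) v 0 (enum_rank a) *: L a.
  have P0 : P = 0.
    apply/mpolyP => u; rewrite mcoeff0.
    have PuS : (msize P <= S.+1)%N.
      apply: leq_trans (msize_sum _ _ _) _; apply/bigmax_leqP => a _.
      exact: leq_trans (msizeZ_le _ _) (sL a).
    have [uS|Su] := ltnP (mdeg u) S.+1; last first.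
      by apply: memN_msupp_eq0; apply: msize_mdeg_ge; apply: leq_trans Su.
    have /rowP/(_ (enum_rank (BMultinom uS : U))) := vA; rewrite !mxE => E0.
    rewrite -[RHS]E0 /P raddf_sum (reindex_onto enum_val enum_rank) /=.
      apply: eq_big => [i|i _]; first by rewrite enum_valK eqxx.
      by rewrite mcoeffZ mxE enum_rankK enum_valK.
    by move=> i _; rewrite enum_rankK.
  transitivity (P.@[fun j => x (enum_val j)]); last by rewrite P0 meval0.
  rewrite raddf_sum /=; apply: eq_bigr => a _.
  rewrite mevalZ rmorph_prod; congr (_ * _); apply: eq_bigr => k _ /=.
  rewrite rmorph_prod; apply: eq_bigr => b _ /=.
  by rewrite mevalB mevalC pq.
Qed.

End AlgebraicDependence.

(** * Krull dimension *)

Section Dimension.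
Local Open Scope classical_set_scope.
Variables (F : numFieldType) (I : finType).
Local Notation V := {ffun I -> F}.
Implicit Types (Y Z : set V) (f g : (I -> F) -> F).

Lemma zariski_closureP Y v : zariski_closure Y v <->
  forall f, polyfun f -> (forall y, Y y -> f y = 0) -> f v = 0.
Proof.
split=> [Yv f pf fY|H Z [S ->] YS p Sp].
  have [p Ep] := polyfun_mpoly pf; rewrite Ep.
  apply: (Yv [set v | forall q, [set p] q -> poly_eval q v = 0]); last exact: erefl.
    by exists [set p].
  by move=> y /fY fy q ->; rewrite /poly_eval -Ep.
have [f pf Ef] := polyfun_poly_eval p.
by rewrite Ef; apply: H => // y /YS /(_ p Sp); rewrite Ef.
Qed.

Lemma sub_zariski_closure Y : Y `<=` zariski_closure Y.
Proof. by move=> y Yy Z _ /(_ _ Yy). Qed.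

Lemma zariski_closed_zeros f : polyfun f -> zariski_closed [set v : V | f v = 0].
Proof.
move=> /polyfun_mpoly[p Ep]; exists [set p]; apply/seteqP; split=> v /=.
  by move=> fv q ->; rewrite /poly_eval -Ep.
by move/(_ p erefl); rewrite Ep.
Qed.

Lemma zariski_closed_closure Y : zariski_closed (zariski_closure Y).
Proof.
exists [set p | forall y, Y y -> poly_eval p y = 0].
apply/seteqP; split=> [v Yv p /= pY|v /= H].
  have [f pf Ef] := polyfun_poly_eval p; rewrite Ef.
  by move/zariski_closureP: Yv; apply=> // y /pY; rewrite Ef.
apply/zariski_closureP => f pf fY; have [p Ep] := polyfun_mpoly pf; rewrite Ep.
by apply: (H p) => y /fY; rewrite Ep.
Qed.

Lemma zariski_closure_min Y Z : zariski_closed Z -> Y `<=` Z ->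
  zariski_closure Y `<=` Z.
Proof. by move=> cZ YZ v; apply. Qed.

Lemma zariski_closure_mono Y Z : Y `<=` Z -> zariski_closure Y `<=` zariski_closure Z.
Proof.
move=> YZ; apply: zariski_closure_min (zariski_closed_closure Z) _.
exact: subset_trans YZ (@sub_zariski_closure Z).
Qed.

Lemma zariski_closed_sep Z v : zariski_closed Z -> ~ Z v ->
  exists f, [/\ polyfun f, forall z, Z z -> f z = 0 & f v != 0].
Proof.
move=> [S ->] /= nZ; apply: contrapT => H; apply: nZ => p Sp.
have [f pf Ef] := polyfun_poly_eval p.
apply: contrapT => pv; apply: H; exists f; split => //.
  by move=> z /(_ p Sp); rewrite Ef.
by rewrite -Ef; apply/eqP.
Qed.

Lemma irreducible_mul Z f g : irreducible Z -> polyfun f -> polyfun g ->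
  (forall z, Z z -> f z * g z = 0) ->
  (forall z, Z z -> f z = 0) \/ (forall z, Z z -> g z = 0).
Proof.
move=> [_ irrZ] pf pg fg.
apply: (irrZ _ _ (zariski_closed_zeros pf) (zariski_closed_zeros pg)) => z /fg.
by move/eqP; rewrite mulf_eq0 => /orP[]/eqP; [left|right].
Qed.

Lemma irreducible_closure Y Z : irreducible Y -> Y `<=` Z ->
  Z `<=` zariski_closure Y -> irreducible Z.
Proof.
move=> [[y Yy] irrY] YZ ZY; split; first by exists y; apply: YZ.
move=> A B cA cB ZAB.
by have [YA|YB] := irrY A B cA cB (subset_trans YZ ZAB); [left|right];
  apply: subset_trans ZY _; apply: zariski_closure_min.
Qed.

(** If y1 is outside A and y2 outside B, polynomials separating them restrict to the curve as p and
    q with p q = 0. One of the two is zero, contradicting its value at 0 or 1. *)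
Lemma irreducible_curve Y : Y !=set0 ->
  (forall y1 y2, Y y1 -> Y y2 -> exists c : I -> {poly F},
     [/\ forall k, (c k).[0] = y1 k, forall k, (c k).[1] = y2 k &
         forall s, Y [ffun k => (c k).[s]]]) -> irreducible Y.
Proof.
move=> Y0 HY; split=> // A B cA cB YAB; apply: contrapT => /not_orP[nA nB].
have [y1 [Yy1 nA1]] : exists y, Y y /\ ~ A y.
  by apply: contrapT => H; apply: nA => y Yy; apply: contrapT => Ay; apply: H; exists y.
have [y2 [Yy2 nB2]] : exists y, Y y /\ ~ B y.
  by apply: contrapT => H; apply: nB => y Yy; apply: contrapT => By; apply: H; exists y.
have [f [pf fA f1]] := zariski_closed_sep cA nA1.
have [g [pg gB g2]] := zariski_closed_sep cB nB2.
have [c [c0 c1 cY]] := HY _ _ Yy1 Yy2.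
have [p Ep] := polyfun_curve c pf; have [q Eq] := polyfun_curve c pg.
have Ec s : (fun k => (c k).[s]) = ([ffun k => (c k).[s]] : V).
  by apply: funext => k; rewrite ffunE.
have pq0 : p * q = 0.
  apply: cofinite_poly_eq0; apply: cofinite_all => s.
  rewrite hornerM -Ep -Eq Ec.
  by have [/fA->|/gB->] := YAB _ (cY s); rewrite ?mul0r ?mulr0.
move/eqP: pq0; rewrite mulf_eq0 => /orP[]/eqP E.
  move: f1; rewrite (_ : (y1 : I -> F) = fun k => (c k).[0]).
    by rewrite Ep E horner0 eqxx.
  by apply: funext.
move: g2; rewrite (_ : (y2 : I -> F) = fun k => (c k).[1]).
  by rewrite Eq E horner0 eqxx.
by apply: funext.
Qed.

(** The family is indexed by [nat] so that it can be extended without casts. *)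
Definition alg_independent Y m (h : nat -> (I -> F) -> F) :=
  forall G : ('I_m -> F) -> F, polyfun G ->
    (forall y, Y y -> G (fun k => h k y) = 0) -> forall x, G x = 0.

(** Take the lowest power g^j in a relation on Z. It cancels because Z is irreducible; on Y, where g
    vanishes, only the coefficient of that power remains, a relation between the h k and hence
    zero. *)
Lemma alg_independent_extend Y Z m h g : irreducible Z -> Y `<=` Z ->
  (forall k, polyfun (h k)) -> polyfun g ->
  (forall y, Y y -> g y = 0) -> ~ (forall z, Z z -> g z = 0) ->
  alg_independent Y m h ->
  alg_independent Z m.+1 (fun k => if k == m then g else h k).
Proof.
move=> irrZ YZ ph pg gY gZ ind G pG GZ.
set h' := fun k => if k == m then g else h k in GZ.
have ph' k : polyfun (h' k) by rewrite /h'; case: ifP.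
have [e [C [sC pC indC EG]]] := polyfun_split ord_max pG.
suff C0 j x : (C x)`_j = 0.
  by move=> x; rewrite EG (_ : C x = 0) ?horner0 //; apply/polyP => j; rewrite C0 coef0.
elim/ltn_ind: j x => j IH.
pose H x := \sum_(i < e | (j <= i)%N) (C x)`_i * x ord_max ^+ (i - j).
have pH : polyfun H.
  apply: polyfun_sum => i _; apply: polyfun_mul => //.
  by apply: polyfun_exp; apply: polyfun_var.
have GH x : G x = x ord_max ^+ j * H x.
  rewrite EG (@horner_coef_wide _ e) // (bigID (fun i : 'I_e => (j <= i)%N)) /=.
  rewrite [X in _ + X]big1 ?addr0 => [|i]; last first.
    by rewrite -ltnNge => ij; rewrite IH // mul0r.
  rewrite big_distrr; apply: eq_bigr => i ji /=.
  by rewrite mulrCA -exprD subnKC.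
have phn (f : ('I_m.+1 -> F) -> F) : polyfun f ->
    polyfun (fun z : I -> F => f (fun k => h' k z)).
  by move=> pf; apply: (@polyfun_comp _ _ _ _ (fun k : 'I_m.+1 => h' k)).
have HZ z : Z z -> H (fun k => h' k z) = 0.
  have K : (forall z, Z z -> g z ^+ j = 0) \/
           (forall z, Z z -> H (fun k => h' k z) = 0).
    apply: (irreducible_mul irrZ (polyfun_exp j pg) (phn _ pH)) => y /GZ.
    by rewrite GH /h' eqxx.
  case: K => [K|K]; last exact: K.
  by case: gZ => y /K/eqP; rewrite expf_eq0 => /andP[_ /eqP].
(* The coefficients ignore the last variable, so they are functions of the first m. *)
pose ext (x : 'I_m -> F) k := if unlift ord_max k is Some k' then x k' else 0.
move=> x; rewrite (indC x (ext (fun k => x (lift ord_max k)))); last first.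
  by move=> i; rewrite /ext; case: unliftP => [i' ->//|->]; rewrite eqxx.
move: (fun k => x _) => {}x.
apply: (ind (fun x => (C (ext x))`_j)).
  apply: (@polyfun_comp _ _ _ (fun x => (C x)`_j) (fun k x => ext x k)) => // k.
  by rewrite /ext; case: unlift => [k'|]; [exact: polyfun_var|exact: polyfun_const].
move=> y Yy; have := HZ y (YZ _ Yy); rewrite /H.
have -> : h' (@ord_max m) y = 0 by rewrite /h' /= eqxx gY.
have [ej _|je] := leqP e j; first by rewrite nth_default // (leq_trans (sC _)).
rewrite (bigD1 (Ordinal je)) //= subnn mulr1 big1 ?addr0 => [|i /andP[ji ij]].
  move=> E; rewrite -[RHS]E; congr ((_ : {poly F})`_j); apply: indC => k; rewrite /ext.
  case: unliftP => [k' ->|->]; last by rewrite eqxx.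
  by rewrite /h' lift_max ltn_eqF.
rewrite expr0n subn_eq0 leqNgt ltn_neqAle ji andbT.
by rewrite eq_sym [_ == j](negbTE ij) mulr0.
Qed.

(** Each strict inclusion supplies a polynomial vanishing on [Z i] but not on [Z i.+1], which is
    adjoined to the family. *)
Lemma irreducible_chain_independent Y m (Z : nat -> set V) : irreducible_chain Y m Z ->
  forall i, (i <= m)%N ->
  exists h, (forall k, polyfun (h k)) /\ alg_independent (Z i) i h.
Proof.
move=> [HZ ltZ]; elim=> [|i IH] im.
  have [_ [[z Zz] _] _] := HZ 0%N im.
  exists (fun=> fun=> 0); split=> [k|G _ /(_ _ Zz) G0 x]; first exact: polyfun_const.
  by rewrite -[RHS]G0; congr G; apply: funext => -[].
have [h [ph ind]] := IH (ltnW im).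
have [cZ' _ _] := HZ i (ltnW im); have [_ irrZ _] := HZ i.+1 im.
have [sZ nZ] := ltZ i im.
have [v [Zv nZv]] : exists v, Z i.+1 v /\ ~ Z i v.
  by apply: contrapT => H; apply: nZ => v Zv; apply: contrapT => Av; apply: H; exists v.
have [g [pg gZ gv]] := zariski_closed_sep cZ' nZv.
exists (fun k => if k == i then g else h k); split=> [k|]; first by case: ifP.
apply: (alg_independent_extend irrZ sZ) => //.
by move=> /(_ v Zv) E; rewrite E eqxx in gv.
Qed.

(** Pulled back along a parametrization whose image is dense in Y, the h k are polynomials in #|K|
    variables, so more than #|K| of them are dependent. *)
Lemma alg_independent_param Y (K : finType) m h (phi : I -> (K -> F) -> F) :
  (forall k, polyfun (h k)) -> (forall i, polyfun (phi i)) ->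
  (forall f, polyfun f -> (forall x, f (phi^~ x) = 0) -> forall y, Y y -> f y = 0) ->
  alg_independent Y m h -> (m <= #|K|)%N.
Proof.
move=> ph pphi dens ind; rewrite leqNgt; apply/negP => Km.
have [|G [pG [x Gx] GK]] := @polyfun_dependent F K m
    (fun k x => h k (phi^~ x)) _ Km.
  by move=> k; apply: polyfun_comp.
move/eqP: Gx; apply; apply: ind => // y Yy.
apply: (dens (fun y => G (fun k => h k y))) => //.
by apply: (@polyfun_comp _ _ _ _ (fun k : 'I_m => h k)).
Qed.

Lemma irreducible_chain_param Y (K : finType) m (Z : nat -> set V)
    (phi : I -> (K -> F) -> F) :
  (forall i, polyfun (phi i)) ->
  (forall f, polyfun f -> (forall x, f (phi^~ x) = 0) -> forall y, Y y -> f y = 0) ->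
  irreducible_chain (zariski_closure Y) m Z -> (m <= #|K|)%N.
Proof.
move=> pphi dens chainZ.
have [h [ph ind]] := irreducible_chain_independent chainZ (leqnn m).
apply: (alg_independent_param ph pphi _ ind) => f pf fphi y Zy.
have [/(_ m (leqnn m))[_ _ sub] _] := chainZ.
by move/zariski_closureP: (sub _ Zy); apply=> //; apply: dens.
Qed.

Lemma zariski_dim_le Y M :
  (forall m (Z : nat -> set V), irreducible_chain (zariski_closure Y) m Z -> (m <= M)%N) ->
  (zariski_dim Y <= M)%N.
Proof.
by move=> H; rewrite /zariski_dim; case: xgetP => // m _ [[Z /H]].
Qed.

(** The coordinates of the ambient space bound all chains by #|I|, so a longest chain exists and
    [xget] returns its length. *)
Lemma zariski_dim_ge Y m (Z : nat -> set V) :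
  irreducible_chain (zariski_closure Y) m Z -> (m <= zariski_dim Y)%N.
Proof.
move=> chainZ.
pose P m := `[< exists Z : nat -> set V, irreducible_chain (zariski_closure Y) m Z >].
have exP : exists m, P m by exists m; apply/asboolP; exists Z.
have ubP m' : P m' -> (m' <= #|I|)%N.
  move=> /asboolP[Z']; apply: (@irreducible_chain_param _ I _ _ (fun i x => x i)).
    by move=> i; apply: polyfun_var.
  by move=> f _ f0 y _; apply: f0.
have [M /asboolP PM maxM] := ex_maxnP exP ubP.
rewrite /zariski_dim; case: xgetP => [M' _ [_ HM]|/(_ M)].
  exact: HM chainZ.
case; split=> // m' Z' cZ'; apply: maxM; apply/asboolP; by exists Z'.
Qed.

(* The chain consists of the closures of the images of coordinate subspaces
   F^0 < ... < F^m; the h k are coordinates at psi 0, tangent to F^m. *)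
Lemma irreducible_chain_ex m (psi : I -> (nat -> F) -> F) (h : nat -> (I -> F) -> F) :
  (forall i, polyfun (psi i)) -> (forall k, polyfun (h k)) ->
  (forall d, exists z : nat -> {poly F}, forall k, (k < m)%N ->
     (z k).[0] = d k /\
     forall s, h k (psi^~ (fun k => s * (if (k < m)%N then d k else 0))) = s * (z k).[s]) ->
  exists Z : nat -> set V, irreducible_chain
    (zariski_closure [set v : V | exists x, forall i, v i = psi i x]) m Z.
Proof.
move=> ppsi ph tan.
pose S i := [set v : V | exists2 x : nat -> F, (forall k, (i <= k)%N -> x k = 0) &
               forall j, v j = psi j x].
have SS i : S i `<=` S i.+1.
  by move=> v [x x0 vx]; exists x => // k ik; apply: x0; apply: ltnW.
exists (fun i => zariski_closure (S i)); split => [i im|i im].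
  split; first exact: zariski_closed_closure.
    apply: (@irreducible_closure (S i)) => //; last exact: sub_zariski_closure.
    apply: irreducible_curve.
      by exists [ffun j => psi j (fun=> 0)], (fun=> 0) => // j; rewrite ffunE.
    move=> y1 y2 [x1 x10 E1] [x2 x20 E2].
    pose l k : {poly F} := (x1 k)%:P + (x2 k - x1 k) *: 'X.
    have /choice[c Ec] j : exists q : {poly F},
      forall s, psi j (fun k => (l k).[s]) = q.[s] by have := polyfun_curve l (ppsi j).
    exists c; split=> [k|k|s].
    - rewrite -Ec E1; congr (psi k _); apply: funext => j.
      by rewrite /l !hornerE.
    - rewrite -Ec E2; congr (psi k _); apply: funext => j.
      by rewrite /l hornerD hornerC hornerZ hornerX mulr1 addrC subrK.
    - exists (fun k => (l k).[s]) => [k ik|j]; last by rewrite ffunE Ec.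
      by rewrite /l x10 // x20 // subrr !hornerE.
  apply: zariski_closure_mono => v [x _ vx]; by exists x.
split; first exact: zariski_closure_mono.
(* If the closures agreed, i parameters would be dense in [S i.+1], while the i + 1 functions h 0,
   ..., h i are independent there. *)
move=> H; have := @alg_independent_param (S i.+1) 'I_i i.+1 h
  (fun j y => psi j (fun k => if insub k is Some k' then y k' else 0)) ph.
rewrite card_ord ltnn => K; apply: notF; apply: K.
- move=> j; apply: (@polyfun_comp _ _ _ _
    (fun k y => if insub k is Some k' then y k' else 0)) => // k.
  by case: insub => [k'|]; [exact: polyfun_var|exact: polyfun_const].
- move=> f pf f0 y Sy.
  have /H/zariski_closureP : zariski_closure (S i.+1) y by exact: sub_zariski_closure.
  apply=> // v [x x0 vx]; rewrite -[RHS](f0 (fun k => x k)).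
  congr f; apply: funext => j; rewrite vx; congr (psi j _); apply: funext => k.
  by case: insubP => [k' _ <-//|]; rewrite -leqNgt => /x0.
- move=> G pG GS; apply: (polyfun_tangent_cone (Y := fun x => G x = 0)) => // d.
  pose d' k := if insub k is Some k' then d k' else 0.
  have [z Hz] := tan d'; exists (fun k => z k); split.
    move=> k; have [-> _] := Hz k (leq_trans (ltn_ord k) im).
    by rewrite /d' valK.
  move=> s; set x := fun k => s * (if (k < m)%N then d' k else 0) in Hz *.
  rewrite -[RHS](GS [ffun j => psi j x]); last first.
    exists x => [k ik|j]; last by rewrite ffunE.
    by rewrite /x /d' insubN -?leqNgt // if_same mulr0.
  congr G; apply: funext => k.
  have [_ /(_ s) <-] := Hz k (leq_trans (ltn_ord k) im).
  by congr (h k _); apply: funext => j; rewrite ffunE.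
Qed.

End Dimension.

(** * Generic ranks of sums of tangent spaces *)

Local Notation evmx s := (map_mx (horner_eval s)).

Section PolyMatrix.
Variable F : numFieldType.

Lemma mxrank_minor m n (A : 'M[F]_(m, n)) :
  exists (L : 'M_(\rank A, m)) (R : 'M_(n, \rank A)), L *m A *m R = 1%:M.
Proof.
have /row_fullP[L EL] := col_base_full A.
have /row_freeP[R ER] := row_base_free A.
exists L, R; transitivity (L *m (col_base A *m row_base A) *m R).
  by rewrite mulmx_base.
by rewrite mulmxA EL mul1mx ER.
Qed.

(** Semicontinuity: the determinant certifying the rank at s0 is a polynomial in s that is nonzero
    at s0. *)
Lemma cofinite_mxrank m n (P : 'M[{poly F}]_(m, n)) s0 :
  cofinite (fun s => \rank (evmx s0 P) <= \rank (evmx s P))%N.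
Proof.
have [L [R LPR]] := mxrank_minor (evmx s0 P).
set r := \rank (evmx s0 P) in L R LPR *.
pose q := \det (map_mx polyC L *m P *m map_mx polyC R).
have Eq s : q.[s] = \det (L *m evmx s P *m R).
  rewrite -[LHS]/(horner_eval s q) -det_map_mx !map_mxM /=; congr (\det (_ *m _ *m _)).
    by apply/matrixP => i j; rewrite !mxE /horner_eval hornerC.
  by apply/matrixP => i j; rewrite !mxE /horner_eval hornerC.
apply: cofinite_impl (@cofinite_horner _ q s0 _) _ => [|s].
  by rewrite Eq LPR det1 oner_neq0.
rewrite Eq -unitfE -unitmxE => /mxrank_unit {1}<-.
by apply: leq_trans (mxrankM_maxl _ _) (mxrankM_maxr _ _).
Qed.

End PolyMatrix.

Section GenericRank.
Local Open Scope classical_set_scope.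
Variables (F : numFieldType) (C : eqType) (J : Type) (q N : nat).
Variable T : C -> (J -> F) -> 'M[F]_(q, N).
Hypothesis polyfunT : forall c i j, polyfun (fun x => T c x i j).
Implicit Types (ks : seq (C * nat)) (s : seq C) (Z : nat -> J -> F).

(** A configuration pairs each component with the label of its point; labels let several
    configurations share points of one assignment Z. *)
Definition tangent_sum ks Z : 'M_N := (\sum_(p <- ks) <<T p.1 (Z p.2)>>)%MS.

Lemma tangent_sum_cons p ks Z :
  (tangent_sum (p :: ks) Z :=: T p.1 (Z p.2) + tangent_sum ks Z)%MS.
Proof.
rewrite /tangent_sum big_cons; apply/eqmxP; apply/andP.
by split; apply: addsmxS; rewrite ?genmxE.
Qed.

Lemma mem_tangent_sum p ks Z : p \in ks -> (T p.1 (Z p.2) <= tangent_sum ks Z)%MS.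
Proof.
elim: ks => // a ks IH; rewrite in_cons tangent_sum_cons => /predU1P[->|/IH pk].
  exact: addsmxSl.
exact: submx_trans pk (addsmxSr _ _).
Qed.

Lemma tangent_sum_sub ks n (B : 'M_(n, N)) Z :
  (forall p, p \in ks -> (T p.1 (Z p.2) <= B)%MS) -> (tangent_sum ks Z <= B)%MS.
Proof.
elim: ks => [|a ks IH] H; first by rewrite /tangent_sum big_nil sub0mx.
rewrite tangent_sum_cons addsmx_sub H ?mem_head //=.
by apply: IH => p pk; apply: H; rewrite in_cons pk orbT.
Qed.

Lemma tangent_sumM ks n (B : 'M_(N, n)) (E : 'M_n) Z :
  (forall p, p \in ks -> (T p.1 (Z p.2) *m B <= E)%MS) ->
  (tangent_sum ks Z *m B <= E)%MS.
Proof.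
elim: ks => [|a ks IH] H; first by rewrite /tangent_sum big_nil mul0mx sub0mx.
rewrite (eqmxMr B (tangent_sum_cons a ks Z)) addsmxMr addsmx_sub H ?mem_head //=.
by apply: IH => p pk; apply: H; rewrite in_cons pk orbT.
Qed.

Lemma tangent_sum_eq ks Z Z' : (forall p, p \in ks -> Z p.2 = Z' p.2) ->
  tangent_sum ks Z = tangent_sum ks Z'.
Proof.
by move=> H; rewrite /tangent_sum !big_seq; apply: eq_bigr => p pk; rewrite H.
Qed.

(** Along the curve the tangent sum is the row space of one stacked polynomial matrix. *)
Lemma cofinite_tangent_sum ks (G : nat -> J -> {poly F}) t0 :
  cofinite (fun t => \rank (tangent_sum ks (fun i j => (G i j).[t0])) <=
                     \rank (tangent_sum ks (fun i j => (G i j).[t])))%N.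
Proof.
have [m [P EP]] : exists m (P : 'M_(m, N)), forall t,
    (tangent_sum ks (fun i j => (G i j).[t]) :=: evmx t P)%MS.
  elim: ks => [|p ks [m [P EP]]].
    exists 0%N, 0 => t; rewrite /tangent_sum big_nil map_mx0.
    by apply/eqmxP; rewrite !sub0mx.
  have /choice[f Ef] (ij : 'I_q * 'I_N) : exists f : {poly F}, forall t,
      T p.1 (fun j => (G p.2 j).[t]) ij.1 ij.2 = f.[t].
    by have := polyfun_curve (G p.2) (polyfunT p.1 ij.1 ij.2).
  pose Q := \matrix_(i, j) f (i, j); exists (q + m)%N, (col_mx Q P) => t.
  apply: eqmx_trans (tangent_sum_cons _ _ _) _.
  rewrite map_col_mx; apply: eqmx_trans (addsmxE _ _).
  apply: adds_eqmx (EP t) => //=.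
  rewrite (_ : T _ _ = evmx t Q) //.
  by apply/matrixP => i j; rewrite !mxE /horner_eval -(Ef (i, j)).
apply: cofinite_impl (cofinite_mxrank P t0) _ => t.
by rewrite !EP.
Qed.

Definition max_rank ks : nat :=
  xget 0%N [set r | (exists Z, \rank (tangent_sum ks Z) = r) /\
                    forall Z, (\rank (tangent_sum ks Z) <= r)%N].

Lemma max_rankP ks : (exists Z, \rank (tangent_sum ks Z) = max_rank ks) /\
  forall Z, (\rank (tangent_sum ks Z) <= max_rank ks)%N.
Proof.
rewrite /max_rank; case: xgetP => [r _ [] //|/=].
pose P r := `[< exists Z, \rank (tangent_sum ks Z) = r >].
have exP : exists r, P r.
  by exists (\rank (tangent_sum ks (fun=> fun=> 0))); apply/asboolP; eexists.
have ubP r : P r -> (r <= N)%N by move=> /asboolP[Z <-]; apply: rank_leq_row.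
have [r /asboolP Pr maxr] := ex_maxnP exP ubP.
by move/(_ r); case; split=> // Z; apply: maxr; apply/asboolP; exists Z.
Qed.

Definition general (K : seq (seq (C * nat))) Z :=
  forall ks, ks \in K -> \rank (tangent_sum ks Z) = max_rank ks.

Lemma general_curve K (G : nat -> J -> {poly F}) t0 :
  general K (fun i j => (G i j).[t0]) ->
  cofinite (fun t => general K (fun i j => (G i j).[t])).
Proof.
move=> gen; apply: cofinite_allT => ks /gen Es.
apply: cofinite_impl (cofinite_tangent_sum ks G t0) _ => t.
rewrite Es => le; apply/eqP; rewrite eqn_leq le andbT.
by have [_] := max_rankP ks.
Qed.

(** On the line joining a point general for K to one of maximal rank for ks, both conditions hold
    for almost all parameters. *)
Lemma general_ex K : exists Z, general K Z.
Proof.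
elim: K => [|ks K [Z HZ]]; first by exists (fun=> fun=> 0).
have [[Z' HZ'] _] := max_rankP ks.
pose G i j : {poly F} := (Z i j)%:P + (Z' i j - Z i j) *: 'X.
have G0 : Z = fun i j => (G i j).[0].
  by apply: funext => i; apply: funext => j; rewrite /G !hornerE.
have G1 : Z' = fun i j => (G i j).[1].
  apply: funext => i; apply: funext => j.
  by rewrite /G hornerD hornerC hornerZ hornerX mulr1 addrC subrK.
have c1 : cofinite (fun t => general K (fun i j => (G i j).[t])).
  by apply: (@general_curve _ _ 0); rewrite -G0.
have c2 : cofinite (fun t => general [:: ks] (fun i j => (G i j).[t])).
  by apply: (@general_curve _ _ 1); rewrite -G1 => k; rewrite inE => /eqP->.
have /cofinite_ex[t [H1 H2]] := cofinite_and c1 c2.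
exists (fun i j => (G i j).[t]) => k; rewrite in_cons => /predU1P[->|/H1//].
by apply: H2; rewrite mem_head.
Qed.

(** Since the labels of ks' are distinct, any points chosen for ks can be copied to ks'; coinciding
    labels only restrict the choice. *)
Lemma max_rank_reindex ks ks' : unzip1 ks = unzip1 ks' -> uniq (unzip2 ks') ->
  (max_rank ks <= max_rank ks')%N.
Proof.
move=> E1 U; have [[Z <-] _] := max_rankP ks.
have sz : size ks = size ks' by have := congr1 size E1; rewrite !size_map.
pose Z' i := Z (nth 0%N (unzip2 ks) (index i (unzip2 ks'))).
have [_ /(_ Z')] := max_rankP ks'; apply: leq_trans; apply: mxrankS.
apply: tangent_sum_sub => p /(nthP p)[i ik <-].
have ik' : (i < size ks')%N by rewrite -sz.
have := @mem_tangent_sum (nth p ks' i) ks' Z' (mem_nth _ ik').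
have <- : (nth p ks i).1 = (nth p ks' i).1.
  by have := congr1 (fun t => nth p.1 t i) E1; rewrite /unzip1 !(nth_map p).
suff -> : Z' (nth p ks' i).2 = Z (nth p ks i).2 by [].
have := nth_map p 0%N snd ik'; rewrite /Z' => <-.
by rewrite index_uniq ?size_map // (nth_map p).
Qed.

Definition generic_rank s := max_rank (zip s (iota 0 (size s))).

Lemma max_rank_uniq ks : uniq (unzip2 ks) -> max_rank ks = generic_rank (unzip1 ks).
Proof.
move=> U; rewrite /generic_rank; set s := unzip1 ks.
have E1 : unzip1 (zip s (iota 0 (size s))) = s by rewrite unzip1_zip ?size_iota.
apply/eqP; rewrite eqn_leq !max_rank_reindex //.
by rewrite unzip2_zip ?size_iota // iota_uniq.
Qed.

Lemma generic_rank_cons s c : (generic_rank s <= generic_rank (c :: s))%N.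
Proof.
pose ks := zip s (iota 1 (size s)).
have E1 : unzip1 ks = s by rewrite unzip1_zip ?size_iota.
have E2 : unzip2 ks = iota 1 (size s) by rewrite unzip2_zip ?size_iota.
have <- : max_rank ks = generic_rank s by rewrite max_rank_uniq ?E1 ?E2 ?iota_uniq.
have <- : max_rank ((c, 0%N) :: ks) = generic_rank (c :: s).
  by rewrite max_rank_uniq /= ?E1 // E2 iota_uniq mem_iota.
have [Z gen] := general_ex [:: ks; (c, 0%N) :: ks].
rewrite -!gen ?inE ?eqxx ?orbT // mxrankS // tangent_sum_cons.
exact: addsmxSr.
Qed.

Lemma generic_rank_le s : (generic_rank s <= N)%N.
Proof.
rewrite /generic_rank; have [[Z <-] _] := max_rankP (zip s (iota 0 (size s))).
exact: rank_leq_row.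
Qed.

(* A is a one-parameter deformation of the identity mapping tangent spaces
   into tangent spaces of the same component. *)
Definition tangent_move (A : 'M[{poly F}]_N) :=
  evmx 0 A = 1%:M /\
  forall c (x : J -> {poly F}), exists y : J -> {poly F},
    (forall j, (y j).[0] = (x j).[0]) /\
    forall t, (T c (fun j => (x j).[t]) *m evmx t A <= T c (fun j => (y j).[t]))%MS.

Lemma tangent_move1 : tangent_move 1%:M.
Proof. by split=> [|c x]; [rewrite map_mx1|exists x; split=> // s; rewrite map_mx1 mulmx1]. Qed.

Lemma tangent_moveM A B : tangent_move A -> tangent_move B -> tangent_move (A *m B).
Proof.
move=> [A0 HA] [B0 HB]; split=> [|c x]; first by rewrite map_mxM A0 B0 mulmx1.
have [y [y0 Hy]] := HA c x; have [z [z0 Hz]] := HB c y.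
exists z; split=> [j|t]; first by rewrite z0.
by rewrite map_mxM mulmxA; apply: submx_trans (Hz t); apply: submxMr.
Qed.

(** Irreducibility of the action: the translates of a nonzero vector lie in no common hyperplane.
    The value of A at 1 may be singular. *)
Hypothesis moves_irreducible : forall (u : 'rV[F]_N) (v : 'cV[F]_N),
  u != 0 -> v != 0 -> exists2 A, tangent_move A & u *m evmx 1 A *m v != 0.

Variable D : nat.
Hypothesis tangent_rank : forall c, exists x, (D <= \rank (T c x))%N.

(* If adding any one point to the configuration s does not enlarge the
   intersection U of a general tangent space of type c with the tangent sum,
   then U does not change when the points of s are replaced one at a time by
   other general points. So U lies in all general tangent sums of type s, and
   the span of its translates, which is the whole space, does too. *)
Lemma generic_rank_full s c :
  (generic_rank (c :: s) < generic_rank s + D)%N ->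
  (forall c', c' \in s -> (generic_rank (c :: s) + generic_rank (c' :: s) <=
      generic_rank [:: c, c' & s] + generic_rank s)%N) ->
  generic_rank s = N.
Proof.
move=> ltD stuck; set n := size s.
(* [H j] is s with its first j points replaced by fresh ones; old labels are i < n, fresh ones n +
   i. [X] is the extra point of type c, and [Y j] the fresh point that replaces the j-th one
   next. *)
pose H j := [seq (nth c s i, if (i < j)%N then n + i else i)%N | i <- iota 0 n].
pose X := (c, n + n)%N; pose Y j := (nth c s j, n + j)%N.
pose K := [:: X] :: [seq H j | j <- iota 0 n.+1] ++ [seq X :: H j | j <- iota 0 n.+1]
  ++ [seq Y j :: H j | j <- iota 0 n] ++ [seq [:: X, Y j & H j] | j <- iota 0 n].
have H1 j : unzip1 (H j) = s.
  by rewrite /unzip1 -map_comp; apply: mkseq_nth.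
pose f j i := (if (i < j)%N then n + i else i)%N.
have H2 j : unzip2 (H j) = [seq f j i | i <- iota 0 n] by rewrite /unzip2 -map_comp.
have uH j : uniq (unzip2 (H j)).
  rewrite H2 map_inj_in_uniq ?iota_uniq // => i i'; rewrite !mem_iota /f.
  case: ifP; case: ifP; lia.
have XH j : (n + n)%N \notin unzip2 (H j).
  rewrite H2; apply/mapP => [[k]]; rewrite mem_iota /f; case: ifP; lia.
have YH j : (j < n)%N -> (n + j)%N \notin unzip2 (H j).
  move=> jn; rewrite H2; apply/mapP => [[k]]; rewrite mem_iota /f; case: ifP; lia.
have rH j : max_rank (H j) = generic_rank s by rewrite max_rank_uniq ?H1.
have rXH j : max_rank (X :: H j) = generic_rank (c :: s).
  by rewrite max_rank_uniq /= ?H1 // XH uH.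
have rYH j : (j < n)%N -> max_rank (Y j :: H j) = generic_rank (nth c s j :: s).
  by move=> jn; rewrite max_rank_uniq /= ?H1 // YH ?uH.
have rXYH j : (j < n)%N ->
    max_rank [:: X, Y j & H j] = generic_rank [:: c, nth c s j & s].
  move=> jn; rewrite max_rank_uniq /= ?H1 // YH // uH andbT.
  rewrite in_cons (negbTE (XH j)) orbF /=; lia.
have KX : [:: X] \in K by rewrite mem_head.
have KH j : (j <= n)%N -> H j \in K.
  move=> jn; rewrite in_cons !mem_cat; apply/orP; right; apply/orP; left.
  by apply: map_f; rewrite mem_iota.
have KXH j : (j <= n)%N -> X :: H j \in K.
  move=> jn; rewrite in_cons !mem_cat; apply/or4P/Or43.
  by apply: (map_f (fun j => X :: H j)); rewrite mem_iota.
have KYH j : (j < n)%N -> Y j :: H j \in K.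
  move=> jn; rewrite in_cons !mem_cat; apply/or4P/Or44/orP; left.
  by apply: (map_f (fun j => Y j :: H j)); rewrite mem_iota.
have KXYH j : (j < n)%N -> [:: X, Y j & H j] \in K.
  move=> jn; rewrite in_cons !mem_cat; apply/or4P/Or44/orP; right.
  by apply: (map_f (fun j => [:: X, Y j & H j])); rewrite mem_iota.
pose U Z := (<<T c (Z (n + n)%N)>> :&: tangent_sum (H 0%N) Z)%MS.
have cap_rank Z ks : (\rank (<<T c (Z (n + n)%N)>> :&: tangent_sum ks Z)%MS +
    \rank (tangent_sum (X :: ks) Z))%N =
    (\rank (T c (Z (n + n)%N)) + \rank (tangent_sum ks Z))%N.
  rewrite addnC {1}/tangent_sum big_cons -/(tangent_sum ks Z) mxrank_sum_cap.
  by rewrite mxrank_gen.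
have UH Z : general K Z -> (U Z <= tangent_sum (H n) Z)%MS.
  move=> gen; suff cap j : (j <= n)%N ->
      (U Z <= <<T c (Z (n + n)%N)>> :&: tangent_sum (H j) Z)%MS.
    exact: submx_trans (cap n (leqnn n)) (capmxSr _ _).
  elim: j => [//|j IH] jn.
  apply: submx_trans (IH (ltnW jn)) _.
  have le (ks ks' : seq (C * nat)) : {subset ks <= ks'} ->
      (<<T c (Z (n + n)%N)>> :&: tangent_sum ks Z <=
       <<T c (Z (n + n)%N)>> :&: tangent_sum ks' Z)%MS.
    move=> sub; apply: capmxS => //; apply: tangent_sum_sub => p /sub.
    exact: mem_tangent_sum.
  (* Both intersections lie in the one for [Y j :: H j], and by [stuck] the one for [H j.+1] already
     has its rank. *)
  have le1 := le (H j) (Y j :: H j) (@mem_behead _ (Y j :: H j)).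
  have le2 : (<<T c (Z (n + n)%N)>> :&: tangent_sum (H j.+1) Z <=
       <<T c (Z (n + n)%N)>> :&: tangent_sum (Y j :: H j) Z)%MS.
    apply: le => p /mapP[k]; rewrite mem_iota add0n /= => kn ->.
    have [->|kj] := eqVneq k j; first by rewrite ltnSn mem_head.
    rewrite in_cons; apply/orP; right; apply/mapP; exists k; first by rewrite mem_iota.
    by rewrite ltnS leq_eqVlt (negbTE kj).
  apply: submx_trans le1 _.
  rewrite -(mxrank_leqif_sup le2).
  have := cap_rank Z (H j.+1); have := cap_rank Z (Y j :: H j).
  rewrite (gen _ (KH _ jn)) (gen _ (KXH _ jn)) (gen _ (KYH _ jn)) (gen _ (KXYH _ jn)).
  rewrite rH rXH rYH // rXYH // eqn_leq (mxrankS le2) /=.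
  have := stuck (nth c s j) (mem_nth c jn); lia.
have U0 Z : general K Z -> U Z != 0.
  move=> gen; rewrite -mxrank_eq0.
  have TD : (D <= \rank (T c (Z (n + n)%N)))%N.
    have -> : \rank (T c (Z (n + n)%N)) = max_rank [:: X].
      by rewrite -gen // /tangent_sum big_seq1 mxrank_gen.
    have [x Dx] := tangent_rank c; have [_ /(_ (fun=> x))] := max_rankP [:: X].
    by apply: leq_trans; rewrite /tangent_sum big_seq1 mxrank_gen.
  have := cap_rank Z (H 0%N).
  rewrite -/(U Z) (gen _ (KH _ (leq0n n))) (gen _ (KXH _ (leq0n n))).
  rewrite rH rXH; lia.
have [Z gen] := general_ex K.
apply/eqP; rewrite eqn_leq generic_rank_le leqNgt; apply/negP => ltN.
set E := tangent_sum (H n) Z.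
have EN : \rank E = generic_rank s by rewrite /E gen ?rH // KH.
(* As E is a proper subspace, some nonzero functional v vanishes on it. *)
have [j v0] : exists j, col j (cokermx E) != 0.
  apply: contrapT => nex; have : cokermx E = 0.
    apply/matrixP => i j; apply: contrapT => ne; apply: nex; exists j.
    by apply/eqP => /colP/(_ i); rewrite !mxE; move: ne; rewrite !mxE.
  move/eqP; rewrite -mxrank_eq0 mxrank_coker EN subn_eq0; lia.
set v := col j _ in v0.
have Ev : E *m v = 0 by rewrite /v colE mulmxA mulmx_coker mul0mx.
have /rowV0Pn[u uU u0] := U0 Z gen.
have [A [A0 Amove] uAv] := moves_irreducible u0 v0.
pose comp i := if i == (n + n)%N then c else nth c s i.
have /choice[y Hy] i : exists y : J -> {poly F}, (forall j, (y j).[0] = Z i j) /\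
    forall t, (T (comp i) (Z i) *m evmx t A <= T (comp i) (fun j => (y j).[t]))%MS.
  have [y [y0 Hy]] := Amove (comp i) (fun j => (Z i j)%:P).
  exists y; split=> [k|t]; first by rewrite y0 hornerC.
  apply: submx_trans (Hy t); rewrite (_ : (fun _ => _) = Z i) //.
  by apply: funext => k; rewrite hornerC.
(* Only the old points and [X] move. The fresh points stay, and with them E, the tangent sum of
   [H n]. *)
pose G i j : {poly F} := if (i < n)%N || (i == n + n)%N then y i j else (Z i j)%:P.
have G0 : (fun i j => (G i j).[0]) = Z.
  apply: funext => i; apply: funext => k; rewrite /G.
  by case: ifP; rewrite ?hornerC // (proj1 (Hy i)).
have cG : cofinite (fun t => general K (fun i j => (G i j).[t])).
  by apply: (@general_curve _ _ 0); rewrite G0.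
pose p := (map_mx polyC u *m A *m map_mx polyC v) 0 0.
have Ep t : p.[t] = (u *m evmx t A *m v) 0 0.
  transitivity (evmx t (map_mx polyC u *m A *m map_mx polyC v) 0 0).
    by rewrite [RHS]mxE.
  rewrite !map_mxM /=.
  congr ((_ *m _ *m _) 0 0); apply/matrixP => i k;
  by rewrite !mxE /horner_eval hornerC.
have p1 : p.[1] != 0.
  by rewrite Ep; apply: contra uAv => /eqP E0; apply/eqP/matrixP => i k;
     rewrite !ord1 E0 mxE.
(* The parameter 1 need not be general, but almost every t is general and keeps u A(t) v nonzero. *)
have [t [gent]] := cofinite_ex (cofinite_and cG (cofinite_horner p1)).
rewrite Ep => /eqP; apply.
set Zt := fun i j => (G i j).[t] in gent.
have Zmove i : (i < n)%N || (i == n + n)%N ->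
    (T (comp i) (Z i) *m evmx t A <= T (comp i) (Zt i))%MS.
  move=> Hi; apply: submx_trans (proj2 (Hy i) t) _.
  by rewrite (_ : Zt i = fun j => (y i j).[t]) // /Zt /G Hi.
have uUt : (u *m evmx t A <= U Zt)%MS.
  move: uU; rewrite !sub_capmx => /andP[uT uH0]; apply/andP; split.
    rewrite genmxE; apply: submx_trans (submxMr _ uT) _.
    have := Zmove (n + n)%N; rewrite eqxx orbT /comp eqxx => /(_ isT).
    by apply: submx_trans; rewrite submxMr ?genmxE.
  apply: submx_trans (submxMr _ uH0) _; apply: tangent_sumM => p' p'H.
  apply: submx_trans (mem_tangent_sum _ p'H).
  have /mapP[k] := p'H; rewrite mem_iota add0n /= => kn -> /=.
  have kn2 : (k == n + n)%N = false by lia.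
  by have := Zmove k; rewrite kn /comp kn2; apply.
(* The moved u lies in the moved intersection, hence in the unmoved E, where v vanishes. *)
have : (u *m evmx t A <= E)%MS.
  apply: submx_trans uUt (submx_trans (UH _ gent) _).
  rewrite /E (@tangent_sum_eq _ _ Z) // => p' /mapP[k].
  rewrite mem_iota add0n /= => kn -> /=; rewrite kn /Zt /G.
  apply: funext => j'; rewrite ifF ?hornerC //; lia.
by move=> /submxP[w ->]; rewrite -mulmxA Ev mulmx0 mxE.
Qed.

(** Induction on the amount by which c enlarges the rank. Unless s is stuck, adding some c' makes
    this amount strictly smaller, so it bounds the number of summands to add. *)
Lemma generic_rank_growth s c :
  (generic_rank (c :: s) < generic_rank s + D)%N ->
  exists2 s', (size s' + generic_rank s <= size s + generic_rank (c :: s))%N &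
              generic_rank s' = N.
Proof.
have [b] := ubnP (generic_rank (c :: s) - generic_rank s).
elim: b s => // b IH s ltb ltD.
have [H|H] := pselect (forall c', c' \in s ->
    (generic_rank (c :: s) + generic_rank (c' :: s) <=
     generic_rank [:: c, c' & s] + generic_rank s)%N).
  by exists s; [rewrite leq_add2l generic_rank_cons|exact: generic_rank_full ltD H].
have {H}[c' H] : exists c', (generic_rank [:: c, c' & s] + generic_rank s <
    generic_rank (c :: s) + generic_rank (c' :: s))%N.
  apply: contrapT => K; apply: H => c' _; rewrite leqNgt; apply/negP => lt.
  by apply: K; exists c'.
have le2 := generic_rank_cons (c' :: s) c.
have [||s' sz Es'] := IH (c' :: s); [move: le2; lia|move: le2; lia|].
by exists s' => //; move: sz => /=; lia.
Qed.

End GenericRank.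

(** * Products of block tensors *)

Section BlockTensors.
Variables (d n l : nat).
Local Notation word := {ffun 'I_d -> 'I_n.+1}.
Local Notation slot := ('I_l * word)%type.
Implicit Types (B : {ffun 'I_d -> 'I_l}) (j : 'I_l) (p : 'I_d) (w v : word).

Definition word0 : word := [ffun=> ord0].

Definition word_mask B j w : word := [ffun p => if B p == j then w p else ord0].

Definition upd w p a : word := [ffun p' => if p' == p then a else w p'].

Lemma word_mask_id B j w : word_mask B j (word_mask B j w) = word_mask B j w.
Proof. by apply/ffunP => p; rewrite !ffunE; case: (B p == j). Qed.

Lemma word_mask_neq B j j' w : j != j' -> word_mask B j (word_mask B j' w) = word0.
Proof.
move=> jj'; apply/ffunP => p; rewrite !ffunE; case: eqP => // ->.
by rewrite (negbTE jj').
Qed.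

Lemma word_mask_eq B w w' : (forall j, word_mask B j w = word_mask B j w') -> w = w'.
Proof.
by move=> E; apply/ffunP => p; have /ffunP/(_ p) := E (B p); rewrite !ffunE eqxx.
Qed.

Lemma word_mask_upd B w p a : word_mask B (B p) (upd w p a) = upd (word_mask B (B p) w) p a.
Proof.
by apply/ffunP => p'; rewrite !ffunE; case: (eqVneq p' p) => [->|//]; rewrite eqxx.
Qed.

Lemma word_mask_upd_neq B j w p a : j != B p -> word_mask B j (upd w p a) = word_mask B j w.
Proof.
move=> jp; apply/ffunP => p'; rewrite !ffunE; case: (eqVneq p' p) => [->|//].
by rewrite eq_sym (negbTE jp).
Qed.

Section Ring.
Variable R : comNzRingType.
Implicit Types (x b y : slot -> R) (g : 'I_n.+1 -> 'I_n.+1 -> R).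

(* The factor of block j of a product is stored as the values of x (j, _) at the
   words vanishing outside block j; the other values of x are irrelevant. *)
Definition tens B x w : R := \prod_j x (j, word_mask B j w).

(** The differential of [tens B] at x in direction b, by the product rule. *)
Definition dtens B x b w : R :=
  \sum_j tens B (fun a => if a.1 == j then b a else x a) w.

Lemma dtensE B x b w : dtens B x b w =
  \sum_j b (j, word_mask B j w) * \prod_(j' | j' != j) x (j', word_mask B j' w).
Proof.
apply: eq_bigr => j _; rewrite /tens (bigD1 j) //= eqxx; congr (_ * _).
by apply: eq_bigr => j' /negbTE ->.
Qed.

Lemma dtens_sum (I : Type) (r : seq I) (P : pred I) B x (c : I -> R) (b : I -> slot -> R) w :
  dtens B x (fun a => \sum_(i <- r | P i) c i * b i a) w =
  \sum_(i <- r | P i) c i * dtens B x (b i) w.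
Proof.
rewrite dtensE (eq_bigr (fun j => \sum_(i <- r | P i) c i * (b i (j, word_mask B j w) *
    \prod_(j' | j' != j) x (j', word_mask B j' w)))); last first.
  by move=> j _; rewrite big_distrl; apply: eq_bigr => i _ /=; rewrite mulrA.
by rewrite exchange_big; apply: eq_bigr => i _ /=; rewrite dtensE big_distrr.
Qed.

Definition act_word p g (v : word -> R) w : R := \sum_a v (upd w p a) * g a (w p).

(** The lift to parameters of a matrix acting on tensor position p: only the factor of the block
    containing p changes. *)
Definition act_slot B p g x (a : slot) : R :=
  if a.1 == B p then \sum_c x (a.1, upd a.2 p c) * g c (a.2 p) else x a.

Lemma act_tens B p g x w : act_word p g (tens B x) w = tens B (act_slot B p g x) w.
Proof.
rewrite /tens (bigD1 (B p)) //= /act_slot eqxx /= big_distrl; apply: eq_bigr => a _ /=.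
rewrite (bigD1 (B p)) //= word_mask_upd mulrAC ffunE eqxx; congr (_ * _).
by apply: eq_bigr => j jp; rewrite (negbTE jp) word_mask_upd_neq.
Qed.

Lemma act_dtens B p g x b w :
  act_word p g (dtens B x b) w = dtens B (act_slot B p g x) (act_slot B p g b) w.
Proof.
rewrite /act_word /dtens (eq_bigr (fun a => \sum_j
  tens B (fun a => if a.1 == j then b a else x a) (upd w p a) * g a (w p))); last first.
  by move=> a _; rewrite big_distrl.
rewrite exchange_big; apply: eq_bigr => j _ /=.
rewrite -/(act_word p g _ w) act_tens; apply: eq_bigr => j' _ /=.
by rewrite /act_slot /=; case: ifP => //; case: ifP.
Qed.

(** The matrix of the differential at x; for general x its row space is the tangent space of the
    cone. *)
Definition tens_mx B x : 'M[R]_(#|{: slot}|, #|{: word}|) :=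
  \matrix_(a, w) dtens B x (fun c => (c == enum_val a)%:R) (enum_val w).

Definition word_row (v : word -> R) : 'rV[R]_#|{: word}| := \row_w v (enum_val w).

Definition act_mx p g : 'M[R]_#|{: word}| :=
  \matrix_(w', w) \sum_a (enum_val w' == upd (enum_val w) p a)%:R * g a (enum_val w p).

Lemma mul_tens_mx B x (b : slot -> R) :
  (\row_a b (enum_val a)) *m tens_mx B x = word_row (dtens B x b).
Proof.
apply/rowP => w; rewrite !mxE.
rewrite [in RHS](_ : b = fun c =>
    \sum_(a < #|{: slot}|) b (enum_val a) * (c == enum_val a)%:R); last first.
  apply: funext => c; rewrite (bigD1 (enum_rank c)) //= enum_rankK eqxx mulr1.
  rewrite big1 ?addr0 // => a; case: (eqVneq c) => [->|_ _]; last by rewrite mulr0.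
  by rewrite enum_valK eqxx.
by rewrite dtens_sum; apply: eq_bigr => a _; rewrite !mxE.
Qed.

Lemma mul_act_mx p g (f : word -> R) :
  word_row f *m act_mx p g = word_row (act_word p g f).
Proof.
apply/rowP => w; rewrite !mxE (eq_bigr (fun i => \sum_a
    (f (enum_val i) * (enum_val i == upd (enum_val w) p a)%:R) * g a (enum_val w p))).
  rewrite exchange_big; apply: eq_bigr => a _ /=.
  rewrite (bigD1 (enum_rank (upd (enum_val w) p a))) //= enum_rankK eqxx mulr1.
  rewrite big1 ?addr0 // => i; case: (eqVneq _ (upd _ _ _)) => [<-|_ _].
    by rewrite enum_valK eqxx.
  by rewrite mulr0 mul0r.
by move=> i _; rewrite !mxE big_distrr; apply: eq_bigr => a _ /=; rewrite mulrA.
Qed.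

End Ring.

Variable F : numFieldType.

Lemma polyfun_tens (L : Type) B w (x : slot -> (L -> F) -> F) :
  (forall a, polyfun (x a)) -> polyfun (fun z => tens B (x^~ z) w).
Proof. by move=> px; apply: polyfun_prod => j _; apply: px. Qed.

Lemma polyfun_tens_mx B i k : polyfun (fun x : slot -> F => tens_mx B x i k).
Proof.
rewrite (_ : (fun _ => _) = fun x : slot -> F => \sum_j tens B (fun a =>
    if a.1 == j then (a == enum_val i)%:R else x a) (enum_val k)).
  apply: polyfun_sum => j _; apply: (@polyfun_tens _ B _ (fun a x =>
    if a.1 == j then (a == enum_val i)%:R else x a)) => a /=.
  by case: (a.1 == j); [exact: polyfun_const|exact: polyfun_var].
by apply: funext => x; rewrite mxE.
Qed.

Lemma horner_tens B (x : slot -> {poly F}) w s :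
  (tens B x w).[s] = tens B (fun a => (x a).[s]) w.
Proof. by rewrite horner_prod. Qed.

(** The line of matrices from the identity at 0 to the matrix unit (a, b) at 1. *)
Definition deform (a b : 'I_n.+1) (c e : 'I_n.+1) : {poly F} :=
  (1 - 'X) *+ (c == e) + 'X *+ ((c == a) && (e == b)).

Lemma evmx_act_mx p (g : 'I_n.+1 -> 'I_n.+1 -> {poly F}) s :
  evmx s (act_mx p g) = act_mx p (fun a b => (g a b).[s]).
Proof.
apply/matrixP => i k; rewrite !mxE /horner_eval horner_sum.
by apply: eq_bigr => a _; rewrite hornerM -polyC_natr hornerC.
Qed.

Lemma deform0 a b c e : (deform a b c e).[0] = (c == e)%:R.
Proof.
rewrite /deform hornerD !hornerMn hornerD hornerN hornerX hornerC.
by rewrite subr0 mul0rn addr0.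
Qed.

Lemma deform1 a b c e : (deform a b c e).[1] = ((c == a) && (e == b))%:R.
Proof.
rewrite /deform hornerD !hornerMn hornerD hornerN hornerX hornerC.
by rewrite subrr mul0rn add0r.
Qed.

(** Acting on one position commutes with block products and their differentials, so the parameters
    moved by [act_slot] are the required y. *)
Lemma tangent_move_act (C : eqType) (Bl : C -> {ffun 'I_d -> 'I_l}) p a b :
  tangent_move (fun c (x : slot -> F) => tens_mx (Bl c) x) (act_mx p (deform a b)).
Proof.
split=> [|c x].
  rewrite evmx_act_mx; apply/matrixP => i k; rewrite !mxE.
  rewrite (bigD1 (enum_val k p)) //= deform0 eqxx mulr1 big1 ?addr0.
    rewrite (_ : upd _ _ _ = enum_val k) ?(inj_eq enum_val_inj) //.
    by apply/ffunP => p'; rewrite ffunE; case: eqP => [->|].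
  by move=> e /negbTE; rewrite deform0 => ->; rewrite mulr0.
exists (act_slot (Bl c) p (deform a b) x); have E s i :
    (act_slot (Bl c) p (deform a b) x i).[s] =
    act_slot (Bl c) p (fun u t => (deform a b u t).[s]) (fun i => (x i).[s]) i.
  rewrite /act_slot; case: ifP => // _; rewrite horner_sum.
  by apply: eq_bigr => e _; rewrite hornerM.
split=> [i|s].
  rewrite E /act_slot; case: ifP => // _.
  rewrite (bigD1 (i.2 p)) //= deform0 eqxx mulr1 big1 ?addr0.
    rewrite (_ : upd _ _ _ = i.2); first by case: i.
    by apply/ffunP => p'; rewrite ffunE; case: eqP => [->|].
  by move=> e /negbTE; rewrite deform0 => ->; rewrite mulr0.
rewrite evmx_act_mx; apply/row_subP => i; rewrite row_mul.
rewrite (_ : row i _ = word_row (dtens (Bl c) (fun i => (x i).[s])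
   (fun c => (c == enum_val i)%:R))); last by apply/rowP => k; rewrite !mxE.
rewrite mul_act_mx (_ : act_word _ _ _ = dtens (Bl c)
   (fun k => (act_slot (Bl c) p (deform a b) x k).[s])
   (act_slot (Bl c) p (fun u t => (deform a b u t).[s]) (fun c => (c == enum_val i)%:R))).
  by rewrite -mul_tens_mx submxMl.
apply: funext => w; rewrite act_dtens; congr (dtens _ _ _ w).
by apply: funext => k; rewrite E.
Qed.

(** Choose nonzero entries u_al and v_be. Composing the deformations at all positions gives, at 1,
    the matrix unit from al to be, and u A v becomes u_al v_be. *)
Lemma tens_moves_irreducible (C : eqType) (Bl : C -> {ffun 'I_d -> 'I_l})
    (u : 'rV[F]_#|{: word}|) (v : 'cV_#|{: word}|) : u != 0 -> v != 0 ->
  exists2 A, tangent_move (fun c (x : slot -> F) => tens_mx (Bl c) x) A &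
             u *m evmx 1 A *m v != 0.
Proof.
move=> u0 v0.
have [i ui] : exists i, u 0 i != 0.
  apply: contrapT => H; move/eqP: u0; apply; apply/rowP => i; rewrite mxE.
  by apply: contrapT => /eqP ui; apply: H; exists i.
have [k vk] : exists k, v k 0 != 0.
  apply: contrapT => H; move/eqP: v0; apply; apply/colP => k; rewrite mxE.
  by apply: contrapT => /eqP vk; apply: H; exists k.
pose al : word := enum_val i; pose be : word := enum_val k.
pose A ps := foldr (fun p M => act_mx p (deform (al p) (be p)) *m M) 1%:M ps.
exists (A (enum 'I_d)).
  elim: (enum 'I_d) => [|p ps IH]; first exact: tangent_move1.
  exact: tangent_moveM (tangent_move_act _ _ _ _) IH.
have EA ps (f : word -> F) : uniq ps -> word_row f *m evmx 1 (A ps) =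
    word_row (fun w => f [ffun p => if p \in ps then al p else w p] *
                       (all (fun p => w p == be p) ps)%:R).
  elim: ps f => [|p ps IH] f /=.
    rewrite map_mx1 mulmx1 => _; apply/rowP => w; rewrite !mxE mulr1; congr f.
    by apply/ffunP => p; rewrite ffunE.
  case/andP => pps ups; rewrite map_mxM mulmxA evmx_act_mx mul_act_mx IH //.
  apply/rowP => w; rewrite !mxE /act_word (bigD1 (al p)) //= deform1 eqxx /=.
  rewrite big1 ?addr0 => [|a /negbTE aal]; last by rewrite deform1 aal mulr0.
  rewrite -mulrA -natrM mulnb ffunE (negbTE pps); congr (f _ * _).
  by apply/ffunP => p'; rewrite !ffunE in_cons; case: eqP => [->|].
have -> : u = word_row (fun w => u 0 (enum_rank w)).
  by apply/rowP => m; rewrite mxE enum_valK.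
rewrite EA ?enum_uniq //; apply/eqP => /matrixP/(_ 0 0)/eqP; apply/negP.
rewrite !mxE (bigD1 k) //= big1 ?addr0 => [|m mk].
  rewrite !mxE (_ : all _ _ = true) ?mulr1; last by apply/allP.
  rewrite mulf_neq0 // (_ : [ffun _ => _] = al) ?enum_valK //.
  by apply/ffunP => p; rewrite ffunE mem_enum.
rewrite mxE; case: allP => [H|_]; last by rewrite mulr0 mul0r.
case/eqP: mk; apply: enum_val_inj; apply/ffunP => p.
by apply/eqP; apply: H; rewrite mem_enum.
Qed.

End BlockTensors.

(** * Sums of block products: tangent spaces, density and dimension *)

Section Joins.
Variables (F : numFieldType) (d n l : nat) (j0 : 'I_l).
Local Notation word := {ffun 'I_d -> 'I_n.+1}.
Local Notation slot := ('I_l * word)%type.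
Implicit Types (B : {ffun 'I_d -> 'I_l}) (j : 'I_l) (p : 'I_d) (w v : word).

(* Coordinates on the slice of normalized parameters: the coefficient at the
   zero word is 1 in every tensor factor except the factor j0. *)
Definition free_slots B : {set slot} :=
  [set a : slot | (word_mask B a.1 a.2 == a.2) && ((a.2 == word0 _ _) ==> (a.1 == j0))].

Lemma word_mask0 B j : word_mask B j (word0 d n) = word0 d n.
Proof. by apply/ffunP => p; rewrite !ffunE if_same. Qed.

(** All words supported in a block count, except the zero word in the l - 1 blocks other than j0. *)
Lemma card_free_slots B :
  (#|free_slots B| + l = \sum_j n.+1 ^ #|[set p | B p == j]| + 1)%N.
Proof.
have card_block j :
    #|[set w : word | word_mask B j w == w]| = (n.+1 ^ #|[set p | B p == j]|)%N.
  transitivity #|pffun_on (ord0 : 'I_n.+1) (mem [set p | B p == j]) predT|; last first.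
    by rewrite card_pffun_on card_ord.
  apply: eq_card => w; rewrite inE; apply/eqP/pffun_onP => [Ew|[supp _]].
    split=> [|//]; apply/fintype.subsetP => p; rewrite !inE; apply: contraNT => Bp.
    by rewrite -Ew ffunE (negbTE Bp).
  apply/ffunP => p; rewrite ffunE; case: ifP => // Bp.
  apply/esym/eqP; move/fintype.subsetP/(_ p): supp; rewrite !inE Bp.
  by case: eqP => // _ /(_ isT).
have card_free j :
  (#|[set w : word | (word_mask B j w == w) && ((w == word0 _ _) ==> (j == j0))]|
    + (j != j0) = n.+1 ^ #|[set p | B p == j]|)%N.
  rewrite -card_block; case: eqP => [->|_] /=.
    by rewrite addn0; apply: eq_card => w; rewrite !inE implybT andbT.
  rewrite [RHS](cardsD1 (word0 d n)) inE word_mask0 eqxx addnC; congr (_ + _)%N.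
  by apply: eq_card => w; rewrite !inE implybF andbC.
rewrite -(eq_bigr _ (fun j _ => card_free j)) big_split /= -addnA; congr (_ + _)%N.
  rewrite -sum1_card (eq_bigr (fun j => \sum_(w : word | (word_mask B j w == w) &&
      ((w == word0 _ _) ==> (j == j0))) 1)%N).
    by rewrite pair_big_dep; apply: eq_bigl => -[j w]; rewrite inE.
  by move=> j _; rewrite sum1_card; apply: eq_card => w; rewrite inE.
rewrite -[LHS](card_ord l) -sum1_card (bigD1 j0) //= [in RHS](bigD1 j0) //= eqxx add0n.
by rewrite addnC; congr (_ + _)%N; apply: eq_bigr => j ->.
Qed.

(** At the product of basis vectors e_0, the derivative in the direction of a free slot is the basis
    tensor of its word, and distinct free slots have distinct words. *)
Lemma tangent_rank_ge B : (#|free_slots B| <=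
  \rank (tens_mx B (fun a : slot => (a.2 == word0 _ _)%:R : F)))%N.
Proof.
set x := fun a : slot => _.
pose M : 'M[F]_(#|free_slots B|, #|{: word}|) :=
  \matrix_(i, k) (enum_val k == (enum_val i).2)%:R.
have MT : M *m M^T = 1%:M.
  apply/matrixP => i k; rewrite !mxE.
  rewrite (bigD1 (enum_rank (enum_val i).2)) //= !mxE enum_rankK eqxx mul1r.
  rewrite big1 ?addr0 => [|m mi]; last first.
    rewrite !mxE; case: eqP => [E|_]; last by rewrite mul0r.
    by case/eqP: mi; rewrite -E enum_valK.
  have := enum_valP i; have := enum_valP k; rewrite !inE.
  move=> /andP[/eqP mk /implyP zk] /andP[/eqP mi /implyP zi].
  rewrite -(inj_eq enum_val_inj) -pair_eqE /pair_eq /=; congr (_%:R : F); congr nat_of_bool.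
  case: (eqVneq (enum_val i).2) => [E|]; last by rewrite andbF.
  rewrite andbT; apply/esym/eqP; have [z|nz] := boolP ((enum_val i).2 == word0 d n).
    by rewrite (eqP (zi z)) (eqP (zk _)) // -E.
  apply: contraNeq nz => ne; rewrite -mi E -mk; apply/eqP.
  exact: word_mask_neq.
have rM : \rank M = #|free_slots B|.
  apply/eqP; rewrite eqn_leq rank_leq_row -{1}(mxrank1 F #|free_slots B|) -MT.
  exact: mxrankM_maxl.
rewrite -[X in (X <= _)%N]rM; apply: mxrankS; apply/row_subP => i.
have -> : row i M = (\row_a (enum_val a == enum_val i :> slot)%:R) *m tens_mx B x.
  rewrite (mul_tens_mx B x (fun c => (c == enum_val i)%:R)).
  apply/rowP => k; rewrite !mxE dtensE.
  rewrite (bigD1 (enum_val i).1) //= [X in _ + X]big1 ?addr0 => [|j ji]; last first.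
    by rewrite -pair_eqE /pair_eq /= (negbTE ji) mul0r.
  have := enum_valP i; rewrite inE => /andP[/eqP mi _].
  rewrite -pair_eqE /pair_eq /= eqxx /=.
  case: (eqVneq (word_mask _ _ _)) => [E|ne]; last first.
    by rewrite mul0r; case: eqP => // E; case/eqP: ne; rewrite E mi.
  rewrite mul1r; case: eqP => [E'|E'].
    rewrite big1 // => j ji; rewrite /x /= E' -mi word_mask_neq ?eqxx //.
  have [j /andP[ji ne]] : exists j, (j != (enum_val i).1) &&
      (word_mask B j (enum_val k) != word0 d n).
    apply: contrapT => H; apply: E'; apply: (@word_mask_eq _ _ _ B) => j.
    have [->|ji] := eqVneq j (enum_val i).1; first by rewrite E mi.
    rewrite -mi word_mask_neq //; apply/eqP; apply: contrapT => ne; apply: H.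
    by exists j; rewrite ji; apply/negP.
  by rewrite (bigD1 j) //= /x /= (negbTE ne) mul0r.
exact: submxMl.
Qed.

(** Each factor other than j0 is divided by its coefficient at the zero word, and factor j0 absorbs
    the scalars. *)
Lemma tens_normalize B (x : slot -> F) : (forall j, x (j, word0 _ _) != 0) ->
  exists y : slot -> F, (forall w, tens B x w =
    tens B (fun a => if a \in free_slots B then y a else 1) w).
Proof.
move=> x0; pose c j := x (j, word0 d n); pose e := \prod_(j | j != j0) c j.
pose y (a : slot) := if a.1 == j0 then x a * e else x a / c a.1.
exists y => w; transitivity (tens B y w).
  rewrite /tens (bigD1 j0) //= [RHS](bigD1 j0) //= /y eqxx -mulrA; congr (_ * _).
  rewrite /e -big_split; apply: eq_bigr => j /negbTE jj /=; rewrite jj mulrC divfK //.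
  exact: x0.
apply: eq_bigr => j _; rewrite inE /= word_mask_id eqxx /=.
case: ifP => // /negbT; rewrite negb_imply => /andP[/eqP -> /negbTE jj].
by rewrite /y /= jj divff //; apply: x0.
Qed.

Variables (C : eqType) (Bl : C -> {ffun 'I_d -> 'I_l}).
Implicit Types (s : seq C).
Local Notation V := {ffun word -> F}.
Local Notation T := (fun c (x : slot -> F) => tens_mx (Bl c) x).
Variable c0 : C.

Definition sum_tens s (Z : nat -> slot -> F) w : F :=
  \sum_(i < size s) tens (Bl (nth c0 s i)) (Z i) w.

Definition sumset s : set V := [set v | exists Z, forall w, v w = sum_tens s Z w]%classic.

Lemma polyfun_sum_tens (L : Type) s w (x : nat -> slot -> (L -> F) -> F) :
  (forall i a, polyfun (x i a)) -> polyfun (fun z => sum_tens s (fun i a => x i a z) w).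
Proof.
by move=> px; apply: polyfun_sum => i _; apply: (@polyfun_tens d n l F L _ w (x i)).
Qed.

(** z is the difference quotient along a line of parameters and equals the differential at 0; this
    is the shape of curve needed for [polyfun_tangent_cone]. *)
Lemma sum_tens_curve s (Z e : nat -> slot -> F) : exists z : word -> {poly F},
  forall w, (z w).[0] = \sum_(i < size s) dtens (Bl (nth c0 s i)) (Z i) (e i) w /\
  forall t, sum_tens s (fun i a => Z i a + t * e i a) w = sum_tens s Z w + t * (z w).[t].
Proof.
pose x i a : {poly F} := (Z i a)%:P + e i a *: 'X.
have deriv_prod (I : eqType) (r : seq I) (f : I -> {poly F}) : uniq r ->
    (\prod_(i <- r) f i)^`() =
    \sum_(i <- r) \prod_(k <- r) (if k == i then (f k)^`() else f k).
  elim: r => [|a r IH] /=; first by rewrite !big_nil derivC.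
  case/andP=> ar ur; rewrite big_cons derivM IH // !big_cons eqxx; congr (_ * _ + _).
    rewrite !big_seq; apply: eq_bigr => k kr; case: eqP => // ka.
    by rewrite -ka kr in ar.
  rewrite big_distrr !big_seq; apply: eq_bigr => k kr /=; rewrite big_cons.
  by case: eqP => // ak; rewrite ak kr in ar.
pose Q w := \sum_(i < size s) tens (Bl (nth c0 s i)) (x i) w.
exists (fun w => drop_poly 1 (Q w)) => w; split.
  rewrite horner_coef0 coef_drop_poly add0n -[LHS]mulr1n -(coef_deriv (Q w) 0).
  rewrite -horner_coef0 /Q raddf_sum horner_sum; apply: eq_bigr => i _ /=.
  rewrite /tens deriv_prod ?index_enum_uniq // horner_sum; apply: eq_bigr => j _.
  rewrite horner_prod; apply: eq_bigr => k _; rewrite /= /x.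
  case: ifP => _; last by rewrite !hornerE.
  by rewrite derivD derivC derivZ derivX !hornerE.
move=> t; have EQ u : (Q w).[u] = sum_tens s (fun i a => Z i a + u * e i a) w.
  rewrite /Q horner_sum; apply: eq_bigr => i _; rewrite horner_tens.
  by apply: eq_bigr => j _; rewrite /x !hornerE mulrC.
rewrite -EQ -{1}(poly_take_drop 1 (Q w)) hornerD hornerM hornerXn expr1 mulrC.
congr (_ + _); rewrite (_ : take_poly 1 (Q w) = (Q w).[0]%:P).
  rewrite hornerC EQ; apply: eq_bigr => i _; apply: eq_bigr => j _.
  by rewrite mul0r addr0.
apply/polyP => -[|m]; rewrite coef_take_poly coefC //=.
by rewrite horner_coef0.
Qed.

Lemma tangent_sum_vec s Z (u : 'rV[F]_#|{: word}|) ks :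
  unzip1 ks = s ->
  (u <= tangent_sum T ks Z)%MS ->
  exists e : nat -> slot -> F, forall w, u 0 (enum_rank w) = \sum_(i < size s)
    dtens (Bl (nth c0 s i)) (Z (nth 0%N (unzip2 ks) i)) (e i) w.
Proof.
move=> <- {s}; elim: ks u => [|p ks IH] u.
  rewrite /tangent_sum big_nil submx0 => /eqP ->; exists (fun=> fun=> 0) => w.
  by rewrite big_ord0 mxE.
rewrite tangent_sum_cons => /sub_addsmxP[[u1 u2] /= Eu].
have [|e He] := IH (u2 *m tangent_sum T ks Z); first exact: submxMl.
exists (fun i => if i is i'.+1 then e i' else fun a => u1 0 (enum_rank a)) => w.
rewrite Eu mxE He big_ord_recl /=; congr (_ + _).
have -> : u1 = \row_a (fun b => u1 0 (enum_rank b)) (enum_val a).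
  by apply/rowP => a; rewrite mxE enum_valK.
rewrite (mul_tens_mx (Bl p.1) (Z p.2) (fun b => u1 0 (enum_rank b))).
rewrite mxE enum_rankK; congr (dtens _ _ _ w); apply: funext => a.
by rewrite mxE enum_rankK.
Qed.

Lemma generic_tangent s : exists Z : nat -> slot -> F,
  exists M : 'M[F]_(generic_rank T s, #|{: word}|), row_free M /\
  exists e : 'I_(generic_rank T s) -> nat -> slot -> F, forall k w,
    M k (enum_rank w) = \sum_(i < size s) dtens (Bl (nth c0 s i)) (Z i) (e k i) w.
Proof.
set ks := zip s (iota 0 (size s)).
have [[Z EZ] _] := max_rankP T ks; exists Z; rewrite /generic_rank -/ks -EZ.
exists (row_base (tangent_sum T ks Z)); split; first exact: row_base_free.
have /choice[e He] k : exists e : nat -> slot -> F, forall w,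
    row_base (tangent_sum T ks Z) k (enum_rank w) =
    \sum_(i < size s) dtens (Bl (nth c0 s i)) (Z i) (e i) w.
  have [||e He] := @tangent_sum_vec s Z (row k (row_base (tangent_sum T ks Z))) ks.
  - by rewrite unzip1_zip ?size_iota.
  - by apply: submx_trans (row_sub _ _) _; rewrite eq_row_base.
  exists e => w; have := He w; rewrite mxE => ->; apply: eq_bigr => i _.
  by rewrite unzip2_zip ?size_iota // nth_iota.
by exists e.
Qed.

(** Where the tangent sum is full, every vector is the initial direction of a curve in the sumset,
    so a polynomial vanishing on the sumset has no lowest homogeneous part there. *)
Lemma sumset_full s : generic_rank T s = #|{: word}| ->
  zariski_closure (sumset s) = setT.
Proof.
move=> full; have [Z [M [freeM [e He]]]] := generic_tangent s.
have Munit : row_full M by rewrite /row_full (eqP freeM) full.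
apply/seteqP; split=> // v _; apply/zariski_closureP => f pf fS.
pose f' (x : word -> F) := f (fun w => sum_tens s Z w + x w).
suff: forall x, f' x = 0.
  move/(_ (fun w => v w - sum_tens s Z w)); rewrite /f'.
  by under eq_fun => w do rewrite addrC subrK.
apply: (@polyfun_tangent_cone F word f'
    (fun y => exists Z', forall w, sum_tens s Z w + y w = sum_tens s Z' w)).
- apply: (@polyfun_comp F word word f (fun w x => sum_tens s Z w + x w)) => // w.
  by apply: polyfun_add; [exact: polyfun_const|exact: polyfun_var].
- move=> b; have /submxP[c Ec] : (\row_i b (enum_val i) <= M)%MS by apply: submx_full.
  pose g i a := \sum_k c 0 k * e k i a.
  have [z Hz] := sum_tens_curve s Z g; exists z; split=> [w|t].
    have [-> _] := Hz w; have /rowP/(_ (enum_rank w)) := Ec.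
    rewrite !mxE enum_rankK => ->.
    rewrite (eq_bigr (fun i : 'I_(size s) => \sum_k c 0 k *
       dtens (Bl (nth c0 s i)) (Z i) (e k i) w)); last by move=> i _; rewrite dtens_sum.
    rewrite exchange_big; apply: eq_bigr => k _ /=; by rewrite He big_distrr.
  exists (fun i a => Z i a + t * g i a) => w.
  by have [_ ->] := Hz w.
move=> y [Z' HZ']; rewrite /f'; pose v' : V := [ffun w => sum_tens s Z' w].
rewrite (_ : (fun w => _) = v'); last by apply: funext => w; rewrite ffunE HZ'.
by apply: fS; exists Z' => w; rewrite ffunE.
Qed.

Lemma sumset_chain s : exists Z : nat -> set V,
  irreducible_chain (zariski_closure (sumset s)) (generic_rank T s) Z.
Proof.
have [Z [M [freeM [e He]]]] := generic_tangent s.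
move: M freeM e He; set m := generic_rank T s => M /row_freeP[L ML] e He.
(* [psi] restricts to the parameters spanned at Z by the directions e, on which the differential is
   injective; [h] reads coordinates along the basis M through its right inverse L. *)
pose psi w (x : nat -> F) := sum_tens s (fun i a => Z i a + \sum_k x (val k) * e k i a) w.
pose h k (y : word -> F) := if insub k is Some k' then
   \sum_w (y w - sum_tens s Z w) * L (enum_rank w) k' else 0.
have [|||Zc [HZ ltZ]] := @irreducible_chain_ex F word m psi h.
- move=> w; apply: polyfun_sum_tens => i a.
  apply: polyfun_add; first exact: polyfun_const.
  apply: polyfun_sum => k _; apply: polyfun_mul; last exact: polyfun_const.
  exact: polyfun_var.
- move=> k; rewrite /h; case: insub => [k'|]; last exact: polyfun_const.
  apply: polyfun_sum => w _; apply: polyfun_mul; last exact: polyfun_const.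
  by apply: polyfun_add; [exact: polyfun_var|exact: polyfun_const].
- move=> b; pose g i a := \sum_(k < m) b k * e k i a.
  have [z Hz] := sum_tens_curve s Z g.
  exists (fun k => if insub k is Some k' then \sum_w L (enum_rank w) k' *: z w else 0).
  move=> k km; rewrite /h (insubT (fun k => k < m)%N km) /=; set k' := Sub k km.
  split=> [|t].
    have <- : (\row_i b (val i) *m M *m L) 0 k' = b k.
      by rewrite -mulmxA ML mulmx1 mxE.
    rewrite horner_sum mxE (reindex_onto enum_val enum_rank) /=; last first.
      by move=> w _; rewrite enum_rankK.
    apply: eq_big => [i|i _]; first by rewrite enum_valK eqxx.
    rewrite hornerZ enum_valK mulrC; congr (_ * _).
    have [-> _] := Hz (enum_val i); rewrite mxE.
    rewrite (eq_bigr (fun i' : 'I_(size s) => \sum_(k < m) b k *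
       dtens (Bl (nth c0 s i')) (Z i') (e k i') (enum_val i))); last first.
      by move=> i' _; rewrite dtens_sum.
    rewrite exchange_big; apply: eq_bigr => k2 _ /=.
    by rewrite mxE -[X in M k2 X]enum_valK He big_distrr.
  rewrite horner_sum big_distrr; apply: eq_bigr => w _ /=.
  have [_ /(_ t) Ew] := Hz w; rewrite hornerZ.
  have -> : psi w (fun k => t * (if (k < m)%N then b k else 0)) =
      sum_tens s (fun i a => Z i a + t * g i a) w.
    apply: eq_bigr => i _; apply: eq_bigr => j _; congr (_ + _).
    rewrite /g big_distrr; apply: eq_bigr => k2 _ /=; by rewrite ltn_ord mulrA.
  by rewrite Ew addrAC subrr add0r mulrAC -mulrA.
exists Zc; split=> // i im; have [cZ iZ sZ] := HZ i im; split=> //.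
apply: subset_trans sZ _; apply: zariski_closure_mono => v [x Ev].
by exists (fun i a => Z i a + \sum_(k < m) x (val k) * e k i a).
Qed.

Variable D : nat.
Hypothesis card_free : forall c, #|free_slots (Bl c)| = D.

(** Almost every product can be normalized, so the free slots of the summands parametrize a dense
    subset. *)
Lemma sumset_chain_le s m (Z : nat -> set V) :
  irreducible_chain (zariski_closure (sumset s)) m Z -> (m <= size s * D)%N.
Proof.
pose P (a : 'I_(size s) * slot) := a.2 \in free_slots (Bl (nth c0 s a.1)).
pose K : finType := {a | P a}.
have cardK : #|K| = (size s * D)%N.
  rewrite card_sig -sum1_card (eq_bigl (fun a => xpredT a.1 && P a)) //.
  rewrite -(pair_big_dep xpredT (fun i a => P (i, a)) (fun _ _ => 1%N)) /=.
  rewrite (eq_bigr (fun=> D)) ?sum_nat_const ?card_ord // => i _.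
  by rewrite sum1_card /P /= -(card_free (nth c0 s i)); apply: eq_card => a.
pose ext (y : K -> F) (i : nat) (a : slot) :=
  if insub i is Some i' then (if insub (i', a) is Some k then y k else 1) else 1.
rewrite -cardK; apply: (@irreducible_chain_param F word _ K m Z
  (fun w y => sum_tens s (ext y) w)).
  move=> w; apply: (@polyfun_sum_tens K s w (fun i a y => ext y i a)) => i a.
  rewrite /ext; case: insub => [i'|]; last exact: polyfun_const.
  by case: insub => [k|]; [exact: polyfun_var|exact: polyfun_const].
move=> f pf f0 v [X Ev].
(* The segment from the given parameters to those with all entries 1, which can be normalized; hence
   so can almost all parameters on it. *)
pose G i a : {poly F} := (X i a)%:P + (1 - X i a) *: 'X.
have /choice[c Ec] w : exists q : {poly F},
    forall t, sum_tens s (fun i a => (G i a).[t]) w = q.[t].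
  have := @polyfun_curve F (nat * slot) (fun x => sum_tens s (fun i a => x (i, a)) w)
    (fun ia => G ia.1 ia.2).
  apply; apply: (@polyfun_sum_tens _ s w (fun i a x => x (i, a))) => i a.
  exact: polyfun_var.
have [q Eq] := polyfun_curve c pf.
suff q0 : q = 0.
  rewrite -[RHS](horner0 0) -[X in X.[_]]q0 -Eq; congr f; apply: funext => w.
  rewrite -Ec Ev; apply: eq_bigr => i _; apply: eq_bigr => j _.
  by rewrite /G !hornerE.
apply: cofinite_poly_eq0.
have nz : cofinite (fun t => forall b, b \in enum {: 'I_(size s) * 'I_l} ->
    (G b.1 (b.2, word0 d n)).[t] != 0).
  apply: cofinite_allT => b _; apply: (@cofinite_horner _ _ 1).
  by rewrite /G hornerD hornerC hornerZ hornerX mulr1 addrC subrK oner_neq0.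
apply: cofinite_impl nz _ => t Gt.
have /choice[y Hy] (i : 'I_(size s)) : exists y : slot -> F, forall w,
    tens (Bl (nth c0 s i)) (fun a => (G i a).[t]) w =
    tens (Bl (nth c0 s i)) (fun a => if a \in free_slots (Bl (nth c0 s i)) then y a else 1) w.
  by apply: tens_normalize => j; apply: (Gt (i, j)); rewrite mem_enum.
rewrite -Eq -[RHS](f0 (fun k => y (val k).1 (val k).2)); congr f; apply: funext => w.
rewrite -Ec; apply: eq_bigr => i _; rewrite Hy; apply: eq_bigr => j _.
rewrite /ext valK; case: insubP => [k Pk Ek|]; last by rewrite /P => /negbTE ->.
by rewrite [X in if X then _ else _]Pk Ek.
Qed.

End Joins.

(** * Partition cones in block coordinates *)

Section PartitionCones.
Variables (F : numFieldType) (n l : nat) (k : 'I_l -> nat).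
Local Notation d := (\sum_i k i)%N.
Local Notation word := {ffun 'I_d -> 'I_n.+1}.
Local Notation slot := ('I_l * word)%type.
Implicit Types (s : 'S_l) (w : word).

Definition position s j (a : 'I_(k (s j))) : 'I_d :=
  cast_ord (sum_perm k s) (@tagnat.Rank l (fun j => k (s j)) j a).

Definition block_of s : {ffun 'I_d -> 'I_l} :=
  [ffun p => @tagnat.sig1 l (fun j => k (s j)) (cast_ord (esym (sum_perm k s)) p)].

Lemma block_of_position s j a : block_of s (@position s j a) = j.
Proof. by rewrite ffunE cast_ordK tagnat.Rank1K. Qed.

Lemma positionP s p : exists a, p = @position s (block_of s p) a.
Proof.
rewrite ffunE; exists (tagnat.sig2 (cast_ord (esym (sum_perm k s)) p)).
by rewrite /position tagnat.sig2K cast_ordKV.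
Qed.

Lemma position_inj s j : injective (@position s j).
Proof.
move=> a b /(congr1 val) /= /eqP; rewrite tagnat.eq_Rank eqxx => /eqP ab.
exact: val_inj.
Qed.

Lemma card_block_of s j : #|[set p | block_of s p == j]| = k (s j).
Proof.
rewrite -[RHS]card_ord -(card_imset predT (@position_inj s j)); apply: eq_card => p.
rewrite inE; apply/eqP/imsetP => [<-|[a _ ->]]; last exact: block_of_position.
by have [a Ea] := positionP s p; exists a.
Qed.

Lemma block_word_mask s j w :
  block_word s (word_mask (block_of s) j w) j = block_word s w j.
Proof.
apply/ffunP => a; rewrite [LHS]ffunE [RHS]ffunE -/(@position s j a) [LHS]ffunE.
by rewrite block_of_position eqxx.
Qed.

(** The word equal to v on the block j with s j = i, and [ord0] elsewhere. Matching on [@eqP] yields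
    the equation along which the position in the block is cast. *)
Definition unblock s i (v : {ffun 'I_(k i) -> 'I_n.+1}) : word :=
  [ffun p => let q := cast_ord (esym (sum_perm k s)) p in
     if @eqP _ (s (tagnat.sig1 q)) i is ReflectT e
     then v (cast_ord (congr1 k e) (@tagnat.sig2 l (fun j => k (s j)) q)) else ord0].

Lemma unblockK s j w : unblock s (block_word s w j) = word_mask (block_of s) j w.
Proof.
apply/ffunP => p; rewrite !ffunE; lazy zeta; set q := cast_ord _ p.
case: (@eqP _ (s (tagnat.sig1 q)) (s j)) => [e|ne]; last first.
  by case: eqP => [jq|//]; case: ne; rewrite jq.
have /eqP jq := perm_inj e; rewrite [tagnat.sig1 q == j]jq ffunE; congr (w _).
apply: val_inj; rewrite /= -[RHS]/(val q) -[in RHS](tagnat.sig2K q).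
by apply/eqP; rewrite tagnat.eq_Rank /= eq_sym jq eqxx.
Qed.

(** The permutation enters only through [block_of s]: the factor t (s j) is stored at the words
    supported in block j. *)
Lemma partition_coneP s (v : {ffun word -> F}) : partition_cone s v <->
  exists x : slot -> F, forall w, v w = tens (block_of s) x w.
Proof.
split=> [[t ->]|[x Ev]].
  exists (fun a => t (s a.1) (block_word s a.2 a.1)) => w; rewrite ffunE.
  by apply: eq_bigr => j _ /=; rewrite block_word_mask.
exists (fun i => [ffun u => x ((s^-1)%g i, unblock s u)]); apply/ffunP => w.
rewrite Ev ffunE; apply: eq_bigr => j _; rewrite ffunE permK unblockK //.
Qed.

End PartitionCones.

(** * Joins of partition cones *)

Local Open Scope classical_set_scope.

Lemma irreducible_chain_sub (F : numFieldType) (I : finType) (Y Y' : set {ffun I -> F})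
    m Z : Y `<=` Y' -> irreducible_chain Y m Z -> irreducible_chain Y' m Z.
Proof.
by move=> YY' [HZ ltZ]; split=> // i /HZ[cZ iZ ZY]; split=> //; apply: subset_trans YY'.
Qed.

Lemma irreducible_prod (F : numFieldType) (I : finType) (Z : set {ffun I -> F})
    (J : Type) (r : seq J) (f : J -> (I -> F) -> F) :
  irreducible Z -> (forall j, polyfun (f j)) ->
  (forall z, Z z -> \prod_(j <- r) f j z = 0) -> exists j, forall z, Z z -> f j z = 0.
Proof.
move=> irrZ pf; elim: r => [|j r IH] H.
  by case: irrZ => -[z /H/eqP]; rewrite big_nil oner_eq0.
have [|z Zz|fj|/IH//] := @irreducible_mul F I Z (f j)
    (fun z => \prod_(j <- r) f j z) irrZ (pf j).
- exact: polyfun_prod.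
- by rewrite -(H z Zz) big_cons.
- by exists j.
Qed.

Section Main.
Variables (F : numFieldType) (n l : nat) (k : 'I_l -> nat) (j0 : 'I_l).
Local Notation d := (\sum_i k i)%N.
Local Notation word := {ffun 'I_d -> 'I_n.+1}.
Local Notation slot := ('I_l * word)%type.
Local Notation V := {ffun word -> F}.
Local Notation X := (@partition_rank1 F n.+1 l k).
Local Notation Bl := (@block_of l k).
Local Notation T := (fun c (x : slot -> F) => tens_mx (Bl c) x).
Local Notation gr := (generic_rank T).
Local Notation sums := (@sumset F d n l _ Bl 1%g).

(** The denominator D of the bounds; [cone_dimE] shows that the truncated subtraction is exact. *)
Definition cone_dim := (\sum_i n.+1 ^ k i + 1 - l)%N.

Lemma cone_dimE : (cone_dim + l = \sum_i n.+1 ^ k i + 1)%N.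
Proof.
rewrite /cone_dim subnK // -[X in (X <= _)%N]card_ord -sum1_card.
by apply: leq_trans (leq_addr _ _); apply: leq_sum => i _; rewrite expn_gt0.
Qed.

Lemma card_free_cone s : #|free_slots n j0 (Bl s)| = cone_dim.
Proof.
apply/eqP; rewrite -(eqn_add2r l) card_free_slots cone_dimE; apply/eqP.
rewrite [in RHS](reindex_inj (@perm_inj _ s)) /=; congr (_ + _)%N.
by apply: eq_bigr => j _; rewrite card_block_of.
Qed.

Lemma cone_dim_gt0 : (0 < cone_dim)%N.
Proof.
rewrite -(card_free_cone 1%g) card_gt0; apply/set0Pn; exists (j0, word0 _ _).
by rewrite inE word_mask0 !eqxx.
Qed.

Lemma card_words : #|{: word}| = (n.+1 ^ d)%N.
Proof. by rewrite card_ffun !card_ord. Qed.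

(** The closure of the sumset contains a chain of length the generic rank, and its chains are
    bounded by the number of free parameters. *)
Lemma generic_rank_le_dim s : (gr s <= size s * cone_dim)%N.
Proof.
have [Z chainZ] := @sumset_chain F d n l _ Bl 1%g s.
exact: (sumset_chain_le card_free_cone chainZ).
Qed.

Lemma generic_rank_fill c s : (gr (c :: s) < gr s + cone_dim)%N ->
  exists2 s', (size s' < size s + cone_dim)%N & gr s' = (n.+1 ^ d)%N.
Proof.
move=> lt; have [|||s' sz Es'] := @generic_rank_growth F _ _ _ _ T _ _ cone_dim _ s c lt.
- by move=> b i m; apply: polyfun_tens_mx.
- by move=> u v; apply: tens_moves_irreducible.
- by move=> b; eexists; rewrite -(card_free_cone b); apply: tangent_rank_ge.
by exists s'; [lia|rewrite Es' card_words].
Qed.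

(** If a summand failed to add its full dimension, fewer than [size s + cone_dim] summands would
    fill the space, although their total dimension is too small. *)
Lemma generic_rank_nondefective s : ((size s + cone_dim) * cone_dim < n.+1 ^ d)%N ->
  (size s * cone_dim <= gr s)%N.
Proof.
elim: s => [|c s IH] /= lt; first by rewrite mul0n.
have ltN : ((size s + cone_dim) * cone_dim < n.+1 ^ d)%N.
  by apply: leq_ltn_trans lt; rewrite leq_mul2r addSn leqnSn orbT.
rewrite mulSn addnC; apply: leq_trans (_ : gr s + cone_dim <= _)%N.
  by rewrite leq_add2r IH.
rewrite leqNgt; apply/negP => /generic_rank_fill[s' sz full].
have := generic_rank_le_dim s'; rewrite full leqNgt => /negP; apply.
by apply: leq_ltn_trans ltN; rewrite leq_mul2r ltnW ?orbT.
Qed.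

Lemma sum_tens_secant s : sums s `<=`
  [set v | exists y : 'I_(size s) -> V,
     (forall i : 'I_(size s), partition_cone (nth 1%g s i) (y i)) /\ v = \sum_i y i].
Proof.
move=> v [Z Ev]; exists (fun i => [ffun w => tens (Bl (nth 1%g s i)) (Z i) w]); split.
  by move=> i; apply/partition_coneP; exists (Z i) => w; rewrite ffunE.
by apply/ffunP => w; rewrite Ev sum_ffunE; apply: eq_bigr => i _; rewrite ffunE.
Qed.

Lemma sums1 c : sums [:: c] = partition_cone c.
Proof.
apply/seteqP; split=> v /=.
  case=> Z Ev; apply/partition_coneP; exists (Z 0%N) => w.
  by rewrite Ev /sum_tens big_ord1.
move/partition_coneP => [x Ev]; exists (fun=> x) => w.
by rewrite Ev /sum_tens big_ord1.
Qed.

Lemma secant_full s : gr s = (n.+1 ^ d)%N -> secant X (size s) = setT.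
Proof.
rewrite -card_words => /(@sumset_full F d n l _ Bl 1%g s) full; apply/seteqP; split=> // v _.
have := I; rewrite -[True]/([set: V] v) -full; apply: zariski_closure_mono.
apply: subset_trans (@sum_tens_secant s) _ => u [y [Hy Eu]].
by exists y; split=> // i; exists (nth 1%g s i).
Qed.

(** If each of N %/ D + 1 copies of one cone added D dimensions, the rank would exceed N. So some
    step adds less, and from there [generic_rank_fill] applies. *)
Lemma generic_rank_exists : exists rg, is_generic_rank X rg /\
  (rg <= (n.+1 ^ d) %/ cone_dim + cone_dim)%N.
Proof.
set N := (n.+1 ^ d)%N; set D := cone_dim.
have [r0 r0N lt] : exists2 r0, (r0 <= N %/ D)%N &
    (gr (1%g :: nseq r0 1%g) < gr (nseq r0 1%g) + D)%N.
  apply: contrapT => H.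
  have ge r : (r <= (N %/ D).+1)%N -> (r * D <= gr (nseq r 1%g))%N.
    elim: r => [|r IH] rN; first by rewrite mul0n.
    rewrite leqNgt; apply/negP => lt; apply: H; exists r => //.
    by apply: leq_trans lt _; rewrite mulSn addnC leq_add2r IH // ltnW.
  have := ge _ (leqnn _); rewrite leqNgt (leq_ltn_trans (generic_rank_le _ _)) //.
  by rewrite card_words ltn_ceil // cone_dim_gt0.
have [s' sz full] := generic_rank_fill lt.
have exP : exists r, `[< secant X r = setT >].
  by exists (size s'); apply/asboolP; apply: secant_full.
have [rg /asboolP Erg min_rg] := ex_minnP exP.
exists rg; split; first by split=> // s Es; apply: min_rg; apply/asboolP.
have le : (rg <= size s')%N by apply: min_rg; apply/asboolP; apply: secant_full.
by move: sz; rewrite size_nseq; lia.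
Qed.

Lemma partition_cone_irreducible c : irreducible (@partition_cone F n.+1 l k c).
Proof.
apply: irreducible_curve.
  exists [ffun w => tens (Bl c) (fun=> 0) w].
  by apply/partition_coneP; exists (fun=> 0) => w; rewrite ffunE.
move=> y1 y2 /partition_coneP[x1 E1] /partition_coneP[x2 E2].
pose x a : {poly F} := (x1 a)%:P + (x2 a - x1 a) *: 'X.
have x_0 a : (x a).[0] = x1 a by rewrite /x !hornerE.
have x_1 a : (x a).[1] = x2 a.
  by rewrite /x hornerD hornerC hornerZ hornerX mulr1 addrC subrK.
exists (fun w => tens (Bl c) x w); split=> [w|w|t].
- by rewrite horner_tens E1; apply: eq_bigr.
- by rewrite horner_tens E2; apply: eq_bigr.
- apply/partition_coneP; exists (fun a => (x a).[t]) => w.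
  by rewrite ffunE horner_tens.
Qed.

(** Irreducibility puts Y in the closure of one cone c of the finite union X. Adjoining c to Y keeps
    it irreducible, so by maximality Y contains c. *)
Lemma component_cone Y : irreducible_component X Y ->
  exists c, partition_cone c `<=` Y /\ Y `<=` zariski_closure (partition_cone c).
Proof.
move=> [irrY YX maxY].
have [c Yc] : exists c, Y `<=` zariski_closure (@partition_cone F n.+1 l k c).
  apply: contrapT => H.
  have /choice[f Hf] c : exists f, [/\ polyfun f,
      forall v : V, partition_cone c v -> f v = 0 & ~ forall v, Y v -> f v = 0].
    apply: contrapT => Hc; apply: H; exists c => v Yv; apply/zariski_closureP => f pf fc.
    apply: contrapT => fv; apply: Hc; exists f; split=> // fY; apply: fv; exact: fY.
  have [||c fc] := @irreducible_prod F word Y _ (index_enum {perm 'I_l}) f irrY.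
  - by move=> c; case: (Hf c).
  - move=> v /YX[c cv]; rewrite (bigD1 c) //=; have [_ -> //] := Hf c.
    by rewrite mul0r.
  by case: (Hf c).
exists c; split=> //.
have <- : Y `|` partition_cone c = Y.
  apply: maxY.
  - apply: irreducible_closure (partition_cone_irreducible c) _ _.
      exact: subsetUr.
    by move=> v [/Yc//|]; apply: sub_zariski_closure.
  - by move=> v [/YX//|cv]; exists c.
  - exact: subsetUl.
exact: subsetUr.
Qed.

(** Each component has dimension at most [cone_dim], while the join contains a sum of r cones whose
    generic rank is at least r times [cone_dim]. *)
Lemma join_nondefective r : ((r + cone_dim) * cone_dim < n.+1 ^ d)%N ->
  r_nondefective X r.
Proof.
move=> lt [Y [compY]]; rewrite /defective_join => def.
have /choice[c Hc] i := component_cone (compY i).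
pose s := [seq c i | i <- enum 'I_r].
have szs : size s = r by rewrite size_map size_enum_ord.
have dimY i : (zariski_dim (Y i) <= cone_dim)%N.
  apply: zariski_dim_le => m Z chainZ; rewrite -[cone_dim]mul1n.
  apply: (@sumset_chain_le F d n l j0 _ Bl 1%g _ card_free_cone [:: c i] m Z).
  rewrite sums1; apply: irreducible_chain_sub chainZ.
  by apply: zariski_closure_min (proj2 (Hc i)); apply: zariski_closed_closure.
have dimJ : (gr s <= zariski_dim (join Y))%N.
  have [Z chainZ] := @sumset_chain F d n l _ Bl 1%g s.
  apply: zariski_dim_ge (irreducible_chain_sub _ chainZ).
  apply: zariski_closure_mono; apply: subset_trans (@sum_tens_secant s) _.
  move=> v [y [Hy Ev]]; apply: sub_zariski_closure.
  exists (fun i => y (cast_ord (esym szs) i)); split=> [i|].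
    apply: (proj1 (Hc i)); have := Hy (cast_ord (esym szs) i).
    by rewrite (nth_map i) ?size_enum_ord //= nth_ord_enum.
  rewrite Ev (reindex (cast_ord (esym szs))) //.
  by exists (cast_ord szs) => i _; apply: val_inj.
have := generic_rank_nondefective (s := s); rewrite szs => /(_ lt) le.
have : (\sum_i zariski_dim (Y i) <= r * cone_dim)%N.
  rewrite -[X in (_ <= X * _)%N]card_ord -sum_nat_const; exact: leq_sum.
by move: def; rewrite leq_min => /andP[]; lia.
Qed.

End Main.

Theorem theorem4p4 (R : realType) (n l : nat) (k : 'I_l -> nat)
    (n_gt0 : (0 < n)%N) (l_gt0 : (0 < l)%N) (k_gt0 : forall i, (0 < k i)%N) :
  let X := @partition_rank1 (complex R) n l k in
  let D : rat := \sum_i (n ^ k i)%:R - l%:R + 1 in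
  let N : rat := (n ^ (\sum_i k i))%:R in
  (exists rg : nat, is_generic_rank X rg /\ rg%:R <= N / D + D) /\
  (forall r : nat, r%:R < N / D - D -> r_nondefective X r).
Proof.
(* A successor n provides the index [ord0] of the vector e_0; j0 is the block that absorbs
   scalars. *)
case: n n_gt0 => // n _; pose j0 := Ordinal l_gt0.
move=> X D N; have ED : D = (cone_dim n k)%:R.
  have := congr1 (fun m => m%:R : rat) (cone_dimE n k); rewrite !natrD natr_sum /D => E.
  by apply: (addIr l%:R); rewrite E addrAC subrK.
have D0 : 0 < D by rewrite ED ltr0n (cone_dim_gt0 n k j0).
split.
  have [rg [Hrg le]] := @generic_rank_exists (complex R) n l k j0.
  exists rg; split=> //; rewrite -(ler_nat rat) natrD -ED in le.
  apply: le_trans le _; rewrite lerD2r ler_pdivlMr // ED -natrM ler_nat.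
  exact: leq_trunc_div.
(* Clearing the denominator turns the hypothesis into (r + D) D < N. *)
move=> r; rewrite ltrBrDr ltr_pdivlMr // ED -natrD -natrM ltr_nat.
exact: (@join_nondefective (complex R) n l k j0).
Qed.
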